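(* Let $q_0$ be a prime power such that $\Delta=\frac{q_0+1}{2}$ is a prime greater than $3$, and let $q=q_0^2$. Let $\mathcal X_1$ be the non-singular model of the plane curve over $\mathbb F_q$ with affine equation $$X^{4}+X^{2}+Y^{q_0+1}=0 .$$ Let $P_1$ be an $\mathbb F_q$-rational point of $\mathcal X_1$ whose Weierstrass semigroup $H(P_1)$ contains the integers $$q_0+1,\ q_0+1-1,\ q_0+1-2,\ \ldots,\ q_0+1-\tfrac{\Delta-1}{2},\ q_0+1-\Delta .$$ Then $$H(P_1)=\left\langle q_0+1,\ (q_0+1)-1,\ (q_0+1)-2,\ \ldots,\ (q_0+1)-\tfrac{\Delta-1}{2},\ q_0+1-\Delta\right\rangle .$$
   Context: Curves are projective, geometrically irreducible, non-singular algebraic curves over a finite field. For an $\mathbb F_q$-rational point $P$, $H(P)$ is the Weierstrass semigroup of non-gaps at $P$: the set of integers $n\ge 0$ such that there is a rational function with pole divisor $nP$. $\langle a_1,\dots,a_r\rangle$ denotes the numerical semigroup (containing $0$) generated by $a_1,\dots,a_r$. It is known (Giulietti–Hirschfeld–Korchmáros–Torres) that $\mathcal X_1$ has genus $q_0-1$ and that a point $P_1$ with the stated property exists. *)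

(* Defs.v *)
From HB Require Import structures.
From mathcomp Require Import all_boot all_order all_algebra.
Set Implicit Arguments.
Unset Strict Implicit.
Unset Printing Implicit Defensive.
Import Order.TTheory GRing.Theory Num.Theory.
Local Open Scope ring_scope.

(* Following the usual dictionary between curves and function fields, the
   non-singular model over F of an irreducible plane curve f(X, Y) = 0 is
   described by its field of F-rational functions
     K = Frac (F[X, Y] / (f)),
   and its (closed) points are the places of K / F, i.e. the normalized
   discrete valuations of K that are trivial on F. *)

(* A bivariate polynomial g : {poly {poly F}} is read with outer variable
   X = 'X and inner variable Y = 'Y = 'X%:P, as in polyXY. *)
Definition eval_at (F K : fieldType) (iota : {rmorphism F -> K}) (x y : K)
    (g : {poly {poly F}}) : K :=
  (map_poly (map_poly iota) g).[x, y].

(* K is the fraction field of F[X, Y] / (f), with x and y the classes of X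
   and Y: the kernel of evaluation at (x, y) is the ideal (f), and every
   element of K is a quotient of polynomial expressions in x and y. *)
Record is_function_field (F K : fieldType) (iota : {rmorphism F -> K})
    (f : {poly {poly F}}) (x y : K) : Prop := IsFunctionField {
  eval_at_eq0 : forall g : {poly {poly F}},
    eval_at iota x y g = 0 <-> exists h : {poly {poly F}}, g = h * f;
  eval_at_quotient : forall z : K, exists g h : {poly {poly F}},
    eval_at iota x y h != 0 /\ z = eval_at iota x y g / eval_at iota x y h
}.

(* The value +oo of a valuation at 0 is replaced by the conventional value 0,
   so that a place is determined by its values on K^*; no other property below
   relies on the value at 0. *)
Record place (F K : fieldType) (iota : {rmorphism F -> K}) := Place {
  place_ord :> K -> int;
  place_ord0 : place_ord 0 = 0;
  place_ordM : forall z w : K, z != 0 -> w != 0 ->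
    place_ord (z * w) = place_ord z + place_ord w;
  place_ordD : forall z w : K, z != 0 -> w != 0 -> z + w != 0 ->
    Num.min (place_ord z) (place_ord w) <= place_ord (z + w);
  place_ord_const : forall c : F, c != 0 -> place_ord (iota c) = 0;
  place_uniformizer : exists t : K, place_ord t = 1
}.

(* P is F-rational: its residue field is F, i.e. every function regular at P
   is congruent to a constant modulo the maximal ideal of P. *)
Definition rational_place (F K : fieldType) (iota : {rmorphism F -> K})
    (P : place iota) : Prop :=
  forall z : K, z != 0 -> 0 <= P z ->
    exists c : F, z = iota c \/ 0 < P (z - iota c).

Definition pole_order (F K : fieldType) (iota : {rmorphism F -> K})
    (P : place iota) (z : K) : int :=
  Num.max 0 (- P z).

(* n belongs to H(P): some rational function z has pole divisor n P. *)
Definition weierstrass_semigroup (F K : fieldType) (iota : {rmorphism F -> K})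
    (P : place iota) (n : nat) : Prop :=
  exists z : K, [/\ z != 0, pole_order P z = n%:Z
    & forall Q : place iota, ~ (Q =1 P) -> pole_order Q z = 0].

Definition generated_semigroup (s : seq nat) (n : nat) : Prop :=
  exists c : nat -> nat, n = (\sum_(i < size s) c i * nth 0 s i)%N.

Definition plane_curve_eqn (F : fieldType) (q0 : nat) : {poly {poly F}} :=
  'X^4 + 'X^2 + 'Y ^+ (q0 + 1).

(* The integers q0 + 1 - j for 0 <= j <= (Delta - 1) / 2, and q0 + 1 - Delta. *)
Definition generators (q0 Delta : nat) : seq nat :=
  rcons [seq (q0 + 1 - j)%N | j <- iota 0 ((Delta - 1) %/ 2).+1]
        (q0 + 1 - Delta)%N.

Definition prime_power (q : nat) : Prop :=
  exists p k : nat, [/\ prime p, (0 < k)%N & q = (p ^ k)%N].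

(* Main.v *)
From HB Require Import structures.
Require Import Defs.
From mathcomp Require Import all_boot all_order all_algebra.
From mathcomp Require Import cyclic separable cyclotomic finfield.
From mathcomp Require Import boolp classical_sets.
From mathcomp Require Import zify ring.
Set Implicit Arguments.
Unset Strict Implicit.
Unset Printing Implicit Defensive.
Import Order.TTheory GRing.Theory Num.Theory.

(** Write D for Delta, an odd number 2k + 1.  The semigroup S generated by the
    given integers has exactly 2D - 2 gaps, and 2D - 2 is the genus of the
    curve.  Since S is contained in H(P1), and since every rational point has
    as many gaps as the genus, the two semigroups are equal.  Only the
    inequality (at least 2D - 2 gaps at P1) has to be proved, and it can be had
    without the Riemann-Roch theorem, by comparing P1 with one well chosen
    rational place Q.

    Comparison of two rational places ([gap_injection]).  For a gap b of Q, let
    g(b) be the least pole order at P1 of the functions that are regular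
    outside P1 and Q and have a pole of order exactly b at Q.  Subtracting a
    constant multiple of another function with the same order at P1 would lower
    the pole at P1; hence g(b) is a gap of P1, and g is injective.  Functions
    with a given pole order at Q exist because their orders at Q form a
    subsemigroup of the integers that contains a positive element and all
    sufficiently negative ones.

    The place Q.  Let i be a square root of -1, and put w = y^D / x and
    u = w + i x.  Then (w + i x)(w - i x) = -1, and the curve becomes
        4 i u^2 y^D = u^4 - 1,
    a cyclic covering of degree D of the u-line, totally ramified at infinity.
    The place Q above u = infinity is unique and rational, with Q(u) = -D and
    Q(y) = -2 ([infinity_unique], [infinity_rational]).

    The gaps of Q ([nongap_infinity]).  A function z is a sum of terms
    a_j(u) y^j with j < D.  The automorphisms y -> c y with c^D = 1 permute the
    places and fix Q, so that averaging over them shows each term to be regular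
    away from Q as soon as z is.  A monomial a(u) y^j that is regular away from
    Q has a polynomial as its coefficient a, by looking at places above the
    zeros of the denominator; and a place above u = 0, where y has a pole, gives
    2j <= D deg a.  So the pole orders at Q have the form 2j + D d with
    2j <= D d, and 2D - 2 explicit integers are gaps.

    Existence of places ([zero_exists]).  The argument needs, for each
    nonconstant t, a place where t vanishes.  A maximal subring containing t
    and the constants, in which t is not invertible, is a valuation ring
    (Chevalley), and it is discrete because the degree of the function field
    over the field of t is finite ([function_field_finite]). *)

(** * Orders at a place *)

Section PlaceTheory.
Local Open Scope ring_scope.
Variables (F K : fieldType) (iota : {rmorphism F -> K}).
Implicit Types (P : place iota) (z w : K).

Lemma place_ord1 P : P 1 = 0.
Proof.
have : P 1 = P 1 + P 1 by rewrite -place_ordM ?oner_neq0 // mul1r.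
lia.
Qed.

Lemma place_ordV P z : P z^-1 = - P z.
Proof.
have [->|z0] := eqVneq z 0; first by rewrite invr0 place_ord0 oppr0.
have zV0 : z^-1 != 0 by rewrite invr_eq0.
have : P 1 = P z + P z^-1 by rewrite -place_ordM // divff.
by rewrite place_ord1; lia.
Qed.

Lemma place_ordZ P c z : c != 0 -> P (iota c * z) = P z.
Proof.
move=> c0; have [->|z0] := eqVneq z 0; first by rewrite mulr0.
by rewrite place_ordM ?fmorph_eq0 // place_ord_const // add0r.
Qed.

Lemma place_ordN P z : P (- z) = P z.
Proof. by rewrite -mulN1r -(rmorph1 iota) -rmorphN place_ordZ // oppr_eq0 oner_neq0. Qed.

Lemma place_ordX P z n : P (z ^+ n) = n%:Z * P z.
Proof.
have [->|z0] := eqVneq z 0.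
  rewrite place_ord0 mulr0; case: n => [|n]; first by rewrite expr0 place_ord1.
  by rewrite expr0n place_ord0.
elim: n => [|n IHn]; first by rewrite expr0 place_ord1 mul0r.
by rewrite exprS place_ordM ?expf_neq0 // IHn; lia.
Qed.

Lemma ord_div P z w : z != 0 -> w != 0 -> P (z / w) = P z - P w.
Proof. by move=> z0 w0; rewrite place_ordM ?invr_eq0 // place_ordV. Qed.

(** The order of 0 is +oo; encoding this in the bound rather than in the value
    makes the lower bounds stable under all ring operations. *)
Definition ord_ge P (n : int) z := (z == 0) || (n <= P z).

Lemma ord_ge0 P n : ord_ge P n 0.
Proof. by rewrite /ord_ge eqxx. Qed.

Lemma ord_geE P n z : z != 0 -> ord_ge P n z = (n <= P z).
Proof. by rewrite /ord_ge => /negPf->. Qed.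

Lemma ord_ge_le P m n z : m <= n -> ord_ge P n z -> ord_ge P m z.
Proof. by rewrite /ord_ge => mn /orP[->//|nz]; rewrite (le_trans mn nz) orbT. Qed.

Lemma ord_ge_const P c : ord_ge P 0 (iota c).
Proof.
have [->|c0] := eqVneq c 0; first by rewrite rmorph0 ord_ge0.
by rewrite /ord_ge place_ord_const // lexx orbT.
Qed.

Lemma ord_geN P n z : ord_ge P n (- z) = ord_ge P n z.
Proof. by rewrite /ord_ge oppr_eq0 place_ordN. Qed.

Lemma ord_geD P n z w : ord_ge P n z -> ord_ge P n w -> ord_ge P n (z + w).
Proof.
have [->|z0] := eqVneq z 0; first by rewrite add0r.
have [->|w0] := eqVneq w 0; first by rewrite addr0.
rewrite /ord_ge (negPf z0) (negPf w0) /= => nz nw.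
have [//|zw0/=] := eqVneq (z + w) 0.
by apply: le_trans (place_ordD P z0 w0 zw0); rewrite le_min nz.
Qed.

Lemma ord_geB P n z w : ord_ge P n z -> ord_ge P n w -> ord_ge P n (z - w).
Proof. by move=> nz nw; apply: ord_geD => //; rewrite ord_geN. Qed.

Lemma ord_geM P m n z w :
  ord_ge P m z -> ord_ge P n w -> ord_ge P (m + n) (z * w).
Proof.
have [->|z0] := eqVneq z 0; first by rewrite mul0r => _ _; apply: ord_ge0.
have [->|w0] := eqVneq w 0; first by rewrite mulr0 => _ _; apply: ord_ge0.
by rewrite !ord_geE ?mulf_neq0 // place_ordM //; apply: lerD.
Qed.

Lemma ord_ge_sum P n (I : Type) (r : seq I) (A : pred I) (G : I -> K) :
  (forall i, A i -> ord_ge P n (G i)) -> ord_ge P n (\sum_(i <- r | A i) G i).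
Proof.
by move=> nG; elim/big_ind: _ => //; [exact: ord_ge0 | exact: ord_geD].
Qed.

(** The strict triangle inequality is an equality: otherwise z, as the
    difference of z + w and w, would have a larger order. *)
Lemma ordD_lt P n z w : z != 0 -> P z < n -> ord_ge P n w ->
  z + w != 0 /\ P (z + w) = P z.
Proof.
move=> z0 zn nw.
have nz m : ord_ge P m z -> m <= P z by rewrite ord_geE.
have zw0 : z + w != 0.
  rewrite addr_eq0; apply/eqP => zE.
  by have /nz : ord_ge P n z; [rewrite zE ord_geN | lia].
split=> //; apply/eqP; rewrite eq_le; apply/andP; split.
  rewrite leNgt; apply/negP => ltz.
  have /nz : ord_ge P (P z + 1) z.
    have zE : z + w - w = z by rewrite addrK.
    rewrite -[X in ord_ge _ _ X]zE; apply: ord_geB.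
      by rewrite ord_geE //; lia.
    by apply: ord_ge_le nw; lia.
  lia.
have : ord_ge P (P z) (z + w).
  apply: ord_geD; first by rewrite ord_geE.
  by apply: ord_ge_le nw; lia.
by rewrite ord_geE.
Qed.

End PlaceTheory.

(** * Comparing the gaps of two rational places *)

Section GapInjection.
Local Open Scope ring_scope.
Variables (F K : fieldType) (iota : {rmorphism F -> K}).
Implicit Types (P Q R : place iota) (z w : K).

Lemma weierstrassE P n z : z != 0 ->
  (forall R, ~ R =1 P -> 0 <= R z) -> P z = - n%:Z -> weierstrass_semigroup P n.
Proof.
move=> z0 regz Pz; exists z; split=> // [|R /regz Rz]; rewrite /pole_order.
  by rewrite Pz; lia.
by lia.
Qed.

Lemma weierstrassP P n : (0 < n)%N -> weierstrass_semigroup P n ->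
  exists z, [/\ z != 0, P z = - n%:Z & forall R, ~ R =1 P -> 0 <= R z].
Proof.
move=> n0 [z [z0 Pz regz]]; exists z; split=> //.
  by move: Pz; rewrite /pole_order; lia.
by move=> R /regz; rewrite /pole_order; lia.
Qed.

Lemma weierstrass0 P : weierstrass_semigroup P 0.
Proof.
apply: (@weierstrassE _ _ 1); rewrite ?oner_neq0 ?place_ord1 ?oppr0 // => R _.
by rewrite place_ord1.
Qed.

Lemma weierstrassD P m n : weierstrass_semigroup P m ->
  weierstrass_semigroup P n -> weierstrass_semigroup P (m + n).
Proof.
case: m => [|m] // Hm; case: n => [|n] Hn; first by rewrite addn0.
have [z [z0 Pz regz]] := weierstrassP (ltn0Sn _) Hm.
have [w [w0 Pw regw]] := weierstrassP (ltn0Sn _) Hn.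
apply: (@weierstrassE _ _ (z * w)); rewrite ?mulf_neq0 //.
  by move=> R RP; rewrite place_ordM // addr_ge0 ?regz ?regw.
by rewrite place_ordM // Pz Pw; lia.
Qed.

Lemma weierstrassM P m k :
  weierstrass_semigroup P m -> weierstrass_semigroup P (k * m).
Proof.
move=> Hm; elim: k => [|k IHk]; first exact: weierstrass0.
by rewrite mulSn; apply: weierstrassD.
Qed.

Lemma weierstrass_eq P Q n :
  P =1 Q -> weierstrass_semigroup P n -> weierstrass_semigroup Q n.
Proof.
move=> PQ [z [z0 Pz regz]]; exists z; split=> //.
  by rewrite /pole_order -PQ.
by move=> R RQ; apply: regz => RP; apply: RQ => t; rewrite RP PQ.
Qed.

Definition regular_off P Q z :=
  z != 0 /\ forall R, ~ R =1 P -> ~ R =1 Q -> ord_ge R 0 z.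

Variables P Q : place iota.
Hypothesis PQ : ~ P =1 Q.

(** At a rational place the quotient of two functions of the same order is
    congruent to a nonzero constant c, and z - c w has a larger order there. *)
Lemma cancel_leading z w : rational_place P ->
  regular_off P Q z -> regular_off P Q w ->
  P z = P w -> Q z < Q w -> 
  exists z', [/\ regular_off P Q z', Q z' = Q z & P z < P z'].
Proof.
move=> ratP [z0 regz] [w0 regw] Pzw Qzw.
have zw0 : z / w != 0 by rewrite mulf_neq0 ?invr_eq0.
have Pq : P (z / w) = 0 by rewrite ord_div // Pzw subrr.
have [|c Hc] := ratP _ zw0; first by rewrite Pq.
have c0 : c != 0.
  apply/eqP => c0; move: Hc; rewrite c0 rmorph0 subr0 Pq.
  by case=> [/eqP|//]; rewrite (negPf zw0).
have w'0 : iota c * w != 0 by rewrite mulf_neq0 ?fmorph_eq0.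
have [|z'0 Qz'] := @ordD_lt _ _ _ Q (Q w) z (- (iota c * w)) z0 Qzw.
  by rewrite ord_geN ord_geE // place_ordZ.
exists (z - iota c * w); split=> //.
  split=> // R RP RQ; apply: ord_geB; first exact: regz.
  by rewrite -[0]add0r; apply: ord_geM; rewrite ?ord_ge_const ?regw.
have zE : z - iota c * w = (z / w - iota c) * w by rewrite mulrBl divfK.
have d0 : z / w - iota c != 0.
  by apply/eqP => d0; move: z'0; rewrite zE d0 mul0r eqxx.
rewrite zE place_ordM //; case: Hc => [Hc|]; last by rewrite Pzw ltrDr.
by move: d0; rewrite Hc subrr eqxx.
Qed.

(** The orders at Q of the functions regular outside P and Q form a semigroup.
    It contains a positive number (subtract from a function with poles only at
    P its value at Q) and all large negative numbers, hence every integer. *)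
Lemma regular_off_exists (h n0 b : nat) : rational_place Q ->
  (0 < h)%N -> weierstrass_semigroup P h ->
  (forall n, (n0 <= n)%N -> weierstrass_semigroup Q n) ->
  exists2 z, regular_off P Q z & Q z = - b%:Z.
Proof.
move=> ratQ h0 Hh Hlarge.
have QP : ~ Q =1 P by move=> QP; apply: PQ => t; rewrite QP.
have [f [f0 Pf regf]] := weierstrassP h0 Hh.
have [c Hc] := ratQ f f0 (regf Q QP).
have [||g0 Pg] := @ordD_lt _ _ _ P 0 f (- iota c) f0.
- by rewrite Pf; lia.
- by rewrite ord_geN ord_ge_const.
set g := f - iota c in g0 Pg.
have Qg : 0 < Q g.
  by case: Hc => // fc; move: g0; rewrite /g -fc subrr eqxx.
have [t Qt] : exists t : nat, Q g = t.+1%:Z.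
  by exists (`|Q g|.-1)%N; lia.
have Hbig : weierstrass_semigroup Q ((b + n0.+1 * t.+1)%N) by apply: Hlarge; nia.
have [|w [w0 Qw regw]] := weierstrassP _ Hbig; first by nia.
exists (w * g ^+ n0.+1); last by rewrite place_ordM ?expf_neq0 // place_ordX Qw Qt PoszD PoszM opprD subrK.
split=> [|R RP RQ]; first by rewrite mulf_neq0 ?expf_neq0.
have Rg : ord_ge R 0 g.
  by rewrite /g ord_geB ?ord_ge_const // ord_geE // regf.
move: Rg; rewrite !ord_geE ?mulf_neq0 ?expf_neq0 //.
rewrite place_ordM ?expf_neq0 // place_ordX => Rg.
by rewrite addr_ge0 ?mulr_ge0 ?regw.
Qed.

(** A gap of Q is sent to the least pole order at P among the functions that
    are regular outside P and Q and have that pole order at Q.  The least value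
    exists because a gap of Q forces a pole at P. *)
Lemma gap_injection_neq (h n0 : nat) :
  rational_place P -> rational_place Q ->
  (0 < h)%N -> weierstrass_semigroup P h ->
  (forall n, (n0 <= n)%N -> weierstrass_semigroup Q n) ->
  exists g : nat -> nat,
    (forall b, ~ weierstrass_semigroup Q b -> ~ weierstrass_semigroup P (g b)) /\
    (forall b b', ~ weierstrass_semigroup Q b -> ~ weierstrass_semigroup Q b' ->
      g b = g b' -> b = b').
Proof.
move=> ratP ratQ h0 Hh Hlarge.
pose E b a := `[< exists z, [/\ regular_off P Q z, Q z = - b%:Z & P z = - a%:Z] >].
have reg_nongap z b : regular_off P Q z -> Q z = - b%:Z -> 0 <= P z ->
    weierstrass_semigroup Q b.
  move=> [z0 regz] Qz Pz; apply: (weierstrassE z0) => // R RQ.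
  have [RP|RP] := EM (R =1 P); first by rewrite RP.
  by have := regz R RP RQ; rewrite ord_geE.
have exE b : ~ weierstrass_semigroup Q b -> exists a, E b a.
  move=> gapb; have [z regz Qz] := regular_off_exists b ratQ h0 Hh Hlarge.
  exists `|P z|%N; apply/asboolP; exists z; split=> //.
  case: (leP 0 (P z)) => [Pz|]; last by lia.
  by case: gapb; apply: reg_nongap Pz.
have gapE b : ~ weierstrass_semigroup Q b ->
    exists a, E b a /\ forall z, regular_off P Q z -> Q z = - b%:Z ->
      P z <= - a%:Z.
  move=> gapb; case: (ex_minnP (exE _ gapb)) => a Ea mina; exists a; split=> //.
  move=> z regz Qz; rewrite leNgt; apply/negP => Pz.
  case: (leP 0 (P z)) => [Pz0|Pz0]; first by case: gapb; apply: reg_nongap Pz0.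
  have /mina : E b `|P z|%N by apply/asboolP; exists z; split=> //; lia.
  lia.
have /choice[g Hg] : forall b, exists a, ~ weierstrass_semigroup Q b -> 
    E b a /\ forall z, regular_off P Q z -> Q z = - b%:Z -> P z <= - a%:Z.
  move=> b; have [Hb|/gapE[a Ha]] := EM (weierstrass_semigroup Q b).
    by exists 0.
  by exists a.
(* Minimality of [g b] excludes a function with the same order at P and a
   milder pole at Q: it would cancel the leading term at P. *)
have reduce b w : ~ weierstrass_semigroup Q b -> regular_off P Q w ->
    P w = - (g b)%:Z -> - b%:Z < Q w -> False.
  move=> gapb regw Pw Qw; have [/asboolP[z [regz Qz Pz]] ming] := Hg b gapb.
  have [||z' [regz' Qz' Pz']] := cancel_leading ratP regz regw.
  - by rewrite Pz Pw.
  - by rewrite Qz.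
  - by have := ming z' regz'; rewrite Qz' => /(_ Qz); lia.
exists g; split=> [b gapb Hgb|b b' gapb gapb' gbb'].
  have b0 : (0 < b)%N by case: b gapb {Hgb} => // -[]; exact: weierstrass0.
  have [w [w0 wreg Pw]] : exists w, [/\ w != 0, 
      (forall R, ~ R =1 P -> 0 <= R w) & P w = - (g b)%:Z].
    case: (posnP (g b)) => [->|/weierstrassP/(_ Hgb)[w [w0 Pw wreg]]].
      by exists 1; split; rewrite ?oner_neq0 ?place_ord1 // => R; rewrite place_ord1.
    by exists w.
  apply: (reduce b w) => //.
    by split=> // R RP _; rewrite ord_geE // wreg.
  have : 0 <= Q w by apply: wreg => QP; apply: PQ => t; rewrite QP.
  lia.
wlog ltbb' : b b' gapb gapb' gbb' / (b < b')%N.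
  move=> wl; case: (ltngtP b b') => // lt; first exact: wl.
  by apply/esym/wl.
have [/asboolP[z [regz Qz Pz]] _] := Hg b gapb.
case: (reduce b' z) => //; first by rewrite -gbb'.
by rewrite Qz; lia.
Qed.

End GapInjection.

Lemma gap_injection (F K : fieldType) (iota : {rmorphism F -> K})
    (P Q : place iota) (h n0 : nat) :
  rational_place P -> rational_place Q ->
  (0 < h)%N -> weierstrass_semigroup P h ->
  (forall n, (n0 <= n)%N -> weierstrass_semigroup Q n) ->
  exists g : nat -> nat,
    (forall b, ~ weierstrass_semigroup Q b -> ~ weierstrass_semigroup P (g b)) /\
    (forall b b', ~ weierstrass_semigroup Q b -> ~ weierstrass_semigroup Q b' ->
      g b = g b' -> b = b').
Proof.
have [PQ|PQ] := EM (P =1 Q); last exact: gap_injection_neq.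
move=> *; exists id; split=> // b gapb Pb.
by apply: gapb; apply: weierstrass_eq Pb.
Qed.

(** * Evaluation of polynomials in the function field *)

Section Eval1.
Local Open Scope ring_scope.
Variables (F K : fieldType) (iota : {rmorphism F -> K}) (t : K).

Definition eval1 (p : {poly F}) : K := (map_poly iota p).[t].

Lemma eval1C c : eval1 c%:P = iota c.
Proof. by rewrite /eval1 map_polyC hornerC. Qed.
Lemma eval1X : eval1 'X = t.
Proof. by rewrite /eval1 map_polyX hornerX. Qed.
Lemma eval1D p q : eval1 (p + q) = eval1 p + eval1 q.
Proof. by rewrite /eval1 rmorphD hornerD. Qed.
Lemma eval1M p q : eval1 (p * q) = eval1 p * eval1 q.
Proof. by rewrite /eval1 rmorphM hornerM. Qed.
Lemma eval1N p : eval1 (- p) = - eval1 p.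
Proof. by rewrite /eval1 rmorphN hornerN. Qed.
Lemma eval1_0 : eval1 0 = 0.
Proof. by rewrite /eval1 rmorph0 horner0. Qed.
Lemma eval1_1 : eval1 1 = 1.
Proof. by rewrite /eval1 rmorph1 hornerC. Qed.
Lemma eval1_exp p n : eval1 (p ^+ n) = eval1 p ^+ n.
Proof. by elim: n => [|n IHn]; rewrite ?expr0 ?eval1_1 // !exprS eval1M IHn. Qed.
End Eval1.

Section EvalAt.
Local Open Scope ring_scope.
Variables (F K : fieldType) (iota : {rmorphism F -> K}) (x y : K).
Notation ev2 := (eval_at iota x y).

Lemma eval_atC c : ev2 c%:P = eval1 iota y c.
Proof. by rewrite /eval_at map_polyC hornerC. Qed.
Lemma eval_atX : ev2 'X = x.
Proof. by rewrite /eval_at map_polyX hornerX hornerC. Qed.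
Lemma eval_atD g h : ev2 (g + h) = ev2 g + ev2 h.
Proof. by rewrite /eval_at rmorphD !hornerD. Qed.
Lemma eval_atN g : ev2 (- g) = - ev2 g.
Proof. by rewrite /eval_at rmorphN !hornerN. Qed.
Lemma eval_atM g h : ev2 (g * h) = ev2 g * ev2 h.
Proof. by rewrite /eval_at rmorphM !hornerM. Qed.
Lemma eval_at0 : ev2 0 = 0.
Proof. by rewrite /eval_at rmorph0 !horner0. Qed.
Lemma eval_at1 : ev2 1 = 1.
Proof. by rewrite /eval_at rmorph1 !hornerC. Qed.
Lemma eval_at_sum (I : Type) (r : seq I) (P : pred I) (G : I -> {poly {poly F}}) :
  ev2 (\sum_(i <- r | P i) G i) = \sum_(i <- r | P i) ev2 (G i).
Proof. exact: (big_morph _ eval_atD eval_at0). Qed.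
Lemma eval_at_prod (I : Type) (r : seq I) (P : pred I) (G : I -> {poly {poly F}}) :
  ev2 (\prod_(i <- r | P i) G i) = \prod_(i <- r | P i) ev2 (G i).
Proof. exact: (big_morph _ eval_atM eval_at1). Qed.
Lemma eval_at_exp g n : ev2 (g ^+ n) = ev2 g ^+ n.
Proof. by elim: n => [|n IHn]; rewrite ?expr0 ?eval_at1 // !exprS eval_atM IHn. Qed.
End EvalAt.

(** * Existence of places *)

(** For t transcendental over F: the degree of K over F(t) is less than N. *)
Definition finite_over (F K : fieldType) (iota : {rmorphism F -> K}) (t : K) (N : nat) :=
  forall z : 'I_N -> K, exists phi : 'I_N -> {poly F},
    (exists i, phi i != 0%R) /\ (\sum_(i < N) eval1 iota t (phi i) * z i = 0)%R.

Section PlaceExistence.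
Local Open Scope ring_scope.
Local Open Scope classical_set_scope.
Variables (F K : fieldType) (iota : {rmorphism F -> K}) (t : K).
Notation ev := (eval1 iota t).
Hypothesis t0 : t != 0.

(** The subrings in which t is not invertible; the maximal ones will be the
    valuation rings of the places where t vanishes. *)
Record admissible (A : set K) : Prop := Admissible {
  adm_const : forall c, A (iota c);
  adm_t : A t;
  adm_add : forall z w, A z -> A w -> A (z + w);
  adm_mul : forall z w, A z -> A w -> A (z * w);
  adm_inv : ~ A t^-1 }.

Lemma maximal_admissible : (forall p, t * ev p != 1) ->
  exists A, admissible A /\ forall B, admissible B -> A `<=` B -> B `<=` A.
Proof.
move=> tev.
have base : admissible [set z | exists p, z = ev p].
  split.
  - by move=> c; exists c%:P; rewrite eval1C.
  - by exists 'X; rewrite eval1X.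
  - by move=> _ _ [p ->] [q ->]; exists (p + q); rewrite eval1D.
  - by move=> _ _ [p ->] [q ->]; exists (p * q); rewrite eval1M.
  - by move=> [p tp]; have := tev p; rewrite -tp divff ?eqxx.
have [|A [[A0|admA] maxA]] := @Zorn_bigcup K (fun A => A = set0 \/ admissible A).
- move=> C CP totC.
  have [[X CX admX]|noX] := EM (exists2 X, C X & admissible X); last first.
    left; rewrite -subset0 => z [X CX Xz]; case: (CP _ CX) => [X0|admX].
      by rewrite X0 in Xz.
    by case: noX; exists X.
  have common z w : (\bigcup_(X in C) X) z -> (\bigcup_(X in C) X) w ->
      exists Y, [/\ C Y, admissible Y, Y z & Y w].
    move=> [Y CY Yz] [Z CZ Zw].
    wlog YZ : Y Z z w CY Yz CZ Zw / Y `<=` Z.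
      move=> wl; have [YZ|ZY] := totC _ _ CY CZ; first exact: (wl Y Z).
      by have [V [CV admV Vw Vz]] := wl Z Y w z CZ Zw CY Yz ZY; exists V.
    exists Z; split=> //; last exact: YZ.
    by case: (CP _ CZ) => // Z0; rewrite Z0 in Zw.
  right; split.
  - by move=> c; exists X => //; apply: adm_const.
  - by exists X => //; apply: adm_t.
  - move=> z w /common H /H[Y [CY admY Yz Yw]]; exists Y => //.
    exact: adm_add.
  - move=> z w /common H /H[Y [CY admY Yz Yw]]; exists Y => //.
    exact: adm_mul.
  - move=> [Y CY Yt]; case: (CP _ CY) => [Y0|admY]; first by rewrite Y0 in Yt.
    exact: adm_inv Yt.
- exfalso; apply: (maxA [set z | exists p, z = ev p]); last by right.
  rewrite A0; split; first exact: sub0set.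
  by move=> /(_ t (adm_t base)).
exists A; split=> // B admB AB.
by apply: contrapT => BA; apply: (maxA B); [split | right].
Qed.

Variable A : set K.
Hypothesis admA : admissible A.
Hypothesis maxA : forall B, admissible B -> A `<=` B -> B `<=` A.

Let Aadd := adm_add admA.
Let Amul := adm_mul admA.
Let At := adm_t admA.
Let Aconst := adm_const admA.
Let A0 : A 0. Proof. by rewrite -(rmorph0 iota); apply: Aconst. Qed.
Let A1 : A 1. Proof. by rewrite -(rmorph1 iota); apply: Aconst. Qed.
Let AN z : A z -> A (- z).
Proof.
by move=> Az; rewrite -mulN1r -(rmorph1 iota) -rmorphN; apply: Amul => //;
  apply: Aconst.
Qed.
Let AX z n : A z -> A (z ^+ n).
Proof.
by move=> Az; elim: n => [|n IHn]; rewrite ?expr0 // exprS; apply: Amul.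
Qed.
Let Asum (I : Type) (r : seq I) (P : pred I) (G : I -> K) :
  (forall i, P i -> A (G i)) -> A (\sum_(i <- r | P i) G i).
Proof. by move=> AG; elim/big_ind: _ => //; apply: Aadd. Qed.
Let Aev p : A (ev p).
Proof.
elim/poly_ind: p => [|p c IHp]; first by rewrite eval1_0.
rewrite eval1D eval1M eval1C eval1X.
by apply: Aadd => //; apply: Amul.
Qed.

(** By maximality t becomes invertible in the ring generated by A and w. *)
Lemma adjoin_inv w : ~ A w ->
  exists p : {poly K}, (forall i, A p`_i) /\ t * p.[w] = 1.
Proof.
move=> Aw; pose B := [set z | exists p : {poly K}, (forall i, A p`_i) /\ z = p.[w]].
have AB : A `<=` B.
  move=> z Az; exists z%:P; rewrite hornerC; split=> // i.
  by rewrite coefC; case: ifP.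
apply: contrapT => noinv; apply: Aw; apply: (maxA (B := B)) => //; last first.
  exists 'X; rewrite hornerX; split=> // i.
  by rewrite coefX; case: (_ == _).
split.
- by move=> c; apply: AB; apply: Aconst.
- by apply: AB; apply: At.
- move=> _ _ [p [Ap ->]] [q [Aq ->]]; exists (p + q); rewrite hornerD; split=> // i.
  by rewrite coefD; apply: Aadd.
- move=> _ _ [p [Ap ->]] [q [Aq ->]]; exists (p * q); rewrite hornerM; split=> // i.
  by rewrite coefM; apply: Asum => j _; apply: Amul.
- by move=> [p [Ap tp]]; apply: noinv; exists p; rewrite -tp divff.
Qed.

(** The elements congruent to 1 modulo t are invertible: an equation
    t p(1/d) = 1 with d = 1 - t b, multiplied by a power of d, would make t
    invertible already in A. *)
Lemma adm_unit1 b : A b -> 1 - t * b != 0 /\ A (1 - t * b)^-1.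
Proof.
move=> Ab; set d := 1 - t * b.
have d0 : d != 0.
  apply/eqP => /subr0_eq tb; apply: (adm_inv admA).
  by have -> : t^-1 = b by rewrite -[t^-1]mulr1 tb mulKf.
split=> //; apply: contrapT => /adjoin_inv[p [Ap tp]].
have dX n : exists2 c, A c & d ^+ n = 1 - t * c.
  elim: n => [|n [c Ac dn]]; first by exists 0; rewrite ?mulr0 ?subr0 ?expr0.
  exists (b + c - t * b * c).
    apply: Aadd; first exact: Aadd.
    by apply/AN/Amul/Ac => //; apply: Amul Ab => //; apply: At.
  by rewrite exprS dn /d; ring.
have [c Ac dn] := dX (size p).
apply: (adm_inv admA).
suff -> : t^-1 = c + \sum_(i < size p) p`_i * d ^+ (size p - i).
  apply: Aadd => //; apply: Asum => i _; apply: Amul => //; apply: AX.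
  by apply: Aadd => //; apply/AN/Amul/Ab => //; apply: At.
apply: (mulfI t0); rewrite divff // mulrDr.
apply: (@addIr _ (- (t * c))); rewrite -dn addrAC subrr add0r.
rewrite -[LHS]mulr1 -tp mulrCA; congr (_ * _).
rewrite horner_coef mulr_sumr; apply: eq_bigr => i _.
by rewrite mulrCA exprVn expfB.
Qed.

(** The second relation expresses w^n by lower powers of w, up to a factor
    that is congruent to 1 modulo t; substituting this in the first relation
    lowers its degree. *)
Lemma chevalley_step w n m (p r : {poly K}) : w != 0 -> (m <= n)%N ->
  (forall i, A p`_i) -> (forall i, A r`_i) ->
  (size p <= n.+1)%N -> (size r <= m.+1)%N ->
  t * p.[w] = 1 -> t * r.[w^-1] = 1 ->
  exists p' : {poly K}, [/\ forall i, A p'`_i, (size p' <= n)%N & t * p'.[w] = 1].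
Proof.
move=> w0 mn Ap Ar sp sr tp tr.
have [d0 Ad] := adm_unit1 (Ar 0%N); set d := 1 - t * r`_0 in d0 Ad.
have srn : (size r <= n.+1)%N by apply: leq_trans sr _.
have wE : w ^+ n = t / d * \sum_(j < n) r`_(n - j) * w ^+ j.
  apply: (mulfI d0); rewrite mulrA mulrCA divff // mulr1 {1}/d mulrBl mul1r.
  rewrite -[X in X - _]mul1r -tr (horner_coef_wide _ srn) -mulrA -mulrA -mulrBr; congr (_ * _).
  rewrite big_ord_recl expr0 mulr1 mulrDl addrC addKr mulr_suml.
  rewrite [RHS](reindex_inj rev_ord_inj) /=; apply: eq_bigr => i _.
  rewrite /bump leq0n add1n subKn ?ltn_ord // -mulrA; congr (_ * _).
  by rewrite exprVn mulrC expfB_cond ?(negPf w0) ?ltn_ord.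
exists (\poly_(j < n) (p`_j + p`_n * (t / d) * r`_(n - j))); split.
- move=> i; rewrite coef_poly; case: ifP => // _.
  apply: Aadd => //; apply: Amul => //; apply: Amul => //.
  by apply: Amul => //; apply: At.
- exact: size_poly.
- rewrite horner_poly -tp (horner_coef_wide _ sp) big_ord_recr /= wE.
  rewrite !mulr_sumr -big_split /= -mulr_sumr; congr (_ * _).
  by apply: eq_bigr => i _; rewrite mulrDl !mulrA.
Qed.

(** Otherwise t is a unit both in A[w] and in A[1/w], and the relations that
    witness this can be shortened until one of them is trivial. *)
Lemma adm_valuation w : A w \/ A w^-1.
Proof.
have [->|w0] := eqVneq w 0; first by left.
have [|Aw] := EM (A w); [by left | right; apply: contrapT => AwV].
have [p [Ap tp]] := adjoin_inv Aw; have [r [Ar tr]] := adjoin_inv AwV.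
pose m := size p; pose n := size r.
have sp : (size p <= m)%N by [].
have sr : (size r <= n)%N by [].
move: m n sp sr => m n; have [k] := ubnP (m + n).
elim: k => // k IHk in w w0 Aw AwV p r m n Ap tp Ar tr *; rewrite ltnS => mnk.
wlog nm : w w0 Aw AwV p r m n Ap tp Ar tr mnk / (n <= m)%N => [wl|] sp sr.
  case: (leqP n m) => [nm|/ltnW mn]; first exact: (wl w _ _ _ p r m n).
  apply: (wl w^-1 _ _ _ r p n m) => //; rewrite ?invrK ?invr_eq0 //.
  by rewrite addnC.
case: n => [|n] in nm mnk sr *.
  by move: tr; rewrite (size_poly_leq0P _ sr) horner0 mulr0 => /esym/eqP; rewrite oner_eq0.
case: m => // m in nm mnk sp *.
have [p' [Ap' sp' tp']] := chevalley_step w0 (nm : (n <= m)%N) Ap Ar sp sr tp tr.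
apply: (IHk w w0 Aw AwV p' r m n.+1) => //; lia.
Qed.

(** Membership in the maximal ideal, formulated so as to include 0. *)
Definition nonunit z := A z /\ forall b, A b -> z * b <> 1.

Lemma nonunitM a z : A a -> nonunit z -> nonunit (a * z).
Proof.
move=> Aa [Az nz]; split=> [|b Ab]; first exact: Amul.
by rewrite mulrAC mulrC => zab; apply: nz zab; apply: Amul.
Qed.

Lemma nonunit0 : nonunit 0.
Proof. by split=> // b _ /esym/eqP; rewrite mul0r oner_eq0. Qed.

Lemma nonunitD z w : nonunit z -> nonunit w -> nonunit (z + w).
Proof.
have [->|z0] := eqVneq z 0; first by rewrite add0r.
have [->|w0] := eqVneq w 0; first by rewrite addr0.
wlog Azw : z w z0 w0 / A (z / w) => [wl nz nw|].
  have [Azw|] := adm_valuation (z / w); first exact: wl.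
  by rewrite invf_div addrC => Awz; apply: wl.
move=> _ nw; have -> : z + w = (z / w + 1) * w by rewrite mulrDl divfK // mul1r.
by apply: nonunitM => //; apply: Aadd.
Qed.

Lemma nonunit_sum (I : Type) (r : seq I) (P : pred I) (G : I -> K) :
  (forall i, P i -> nonunit (G i)) -> nonunit (\sum_(i <- r | P i) G i).
Proof. by move=> nG; elim/big_ind: _ => //; [exact: nonunit0 | exact: nonunitD]. Qed.

Lemma nonunit_t : nonunit t.
Proof.
split=> [|b Ab tb]; first exact: At.
by apply: (adm_inv admA); have -> : t^-1 = b by rewrite -[t^-1]mulr1 -tb mulKf.
Qed.

Lemma nonunit_const c : c != 0 -> ~ nonunit (iota c).
Proof.
move=> c0 [_ /(_ (iota c^-1))]; rewrite -rmorphM divff // rmorph1; apply => //.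

Qed.

Lemma nonunitN z : nonunit z -> nonunit (- z).
Proof. by move=> nz; rewrite -mulN1r; apply: nonunitM => //; apply: AN. Qed.

Lemma nonunitPn z : z != 0 -> A z -> ~ nonunit z -> A z^-1.
Proof.
move=> z0 Az nz; apply: contrapT => AzV; apply: nz; split=> // b Ab zb.
by apply: AzV; have -> : z^-1 = b by rewrite -[z^-1]mulr1 -zb mulKf.
Qed.

Lemma ev_split phi : exists e, ev phi = iota phi`_0 + t * ev e /\
  phi = e * 'X + (phi`_0)%:P.
Proof.
elim/poly_ind: phi => [|p c _].
  by exists 0; rewrite coef0 mul0r eval1_0 rmorph0 mulr0 !addr0.
exists p; rewrite coefD coefMX coefC /= add0r eval1D eval1M eval1X eval1C addrC.
by rewrite mulrC.
Qed.

(** Dividing out the common power of the variable. *)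
Lemma relation_primitive N (x : 'I_N -> K) (phi : 'I_N -> {poly F}) i0 :
  phi i0 != 0 -> \sum_(i < N) ev (phi i) * x i = 0 ->
  exists psi : 'I_N -> {poly F},
    (exists i, (psi i)`_0 != 0) /\ \sum_(i < N) ev (psi i) * x i = 0.
Proof.
have [n] := ubnP (size (phi i0)); elim: n => // n IHn in phi *; rewrite ltnS => sphi.
move=> phi0 rel.
case: (pickP (fun i => (phi i)`_0 != 0)) => [i Hi|Hphi].
  by exists phi; split=> //; exists i.
have /choice[psi Hpsi] : forall i, exists e, phi i = e * 'X.
  move=> i; have [e [_ He]] := ev_split (phi i); exists e; rewrite {1}He.
  by move/negbFE/eqP: (Hphi i) => ->; rewrite addr0.
have psi0 : psi i0 != 0 by apply: contraNneq phi0 => e0; rewrite Hpsi e0 mul0r.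
apply: (IHn psi) => //.
  by move: sphi; rewrite Hpsi size_mulX.
apply: (mulfI t0); rewrite mulr0 -[RHS]rel mulr_sumr; apply: eq_bigr => i _.
by rewrite Hpsi eval1M eval1X mulrCA mulrA.
Qed.

Variable N : nat.
Hypothesis finK : finite_over iota t N.

(** A linear relation over F[t] between elements with pairwise different
    orders, all of them at most the order of t, would have a unique dominant
    term: the last index whose coefficient does not vanish at 0. *)
Lemma no_infinite_chain (x : nat -> K) : x 0%N = t ->
  (forall i, nonunit (x i)) -> (forall i, x i != 0) ->
  (forall i, nonunit (x i / x i.+1)) -> False.
Proof.
move=> x0t nx x0 nxx.
have nxij i j : (i < j)%N -> nonunit (x i / x j).
  elim: j => // j IHj; rewrite ltnS leq_eqVlt => /orP[/eqP->//|/IHj H].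
  have -> : x i / x j.+1 = x i / x j * (x j / x j.+1).
    by rewrite mulrA divfK.
  by apply: nonunitM => //; case: H.
have [phi [[i0 phi0] rel]] := finK (fun i => x i).
have {phi phi0 rel}[phi [[i1 phi1] rel]] := relation_primitive phi0 rel.
(* For i < j the ratio x_i / x_j is a nonunit; for i > j the coefficient of
   x_i is divisible by t, which absorbs the denominator x_j. *)
case: (@arg_maxnP _ i1 (fun i => (phi i)`_0 != 0) (fun i => i : nat) phi1) => j phij maxj.
have [e [ej _]] := ev_split (phi j).
apply: (nonunit_const phij).
have -> : iota (phi j)`_0 = - (t * ev e + \sum_(i < N | i != j) ev (phi i) * (x i / x j)).
  apply/eqP; rewrite -addr_eq0 addrA -ej; apply/eqP; apply: (mulIf (x0 j)).
  rewrite mul0r -[RHS]rel [RHS](bigD1 j) //= mulrDl mulr_suml; congr (_ + _).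
  by apply: eq_bigr => i _; rewrite -mulrA divfK.
apply: nonunitN; apply: nonunitD.
  by rewrite mulrC; apply: nonunitM => //; apply: nonunit_t.
apply: nonunit_sum => i ij; case: (ltngtP i j) => [lt|gt|/val_inj eq].
- by apply: nonunitM => //; apply: nxij.
- have phii : (phi i)`_0 = 0.
    by apply/eqP; apply: contraTT gt => /maxj; rewrite -leqNgt.
  have [e' [-> _]] := ev_split (phi i); rewrite phii rmorph0 add0r.
  have -> : t * ev e' * (x i / x j) = ev e' * (t / x j) * x i.
    by rewrite -!mulrA mulrCA; congr (_ * _); congr (_ * _); rewrite mulrC.
  apply: nonunitM => //; apply: Amul => //; rewrite -x0t.
  case: (posnP j) => [->|j0]; first by rewrite divff.
  by case: (nxij _ _ j0).
- by rewrite eq eqxx in ij.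
Qed.

(** Without a generator of the maximal ideal, elements of smaller and smaller
    positive order could be chosen for ever, starting from t. *)
Lemma uniformizer_exists :
  exists s, [/\ s != 0, nonunit s & forall z, nonunit z -> A (z / s)].
Proof.
apply: contrapT => nos.
have step z : exists z', z != 0 -> nonunit z ->
    [/\ z' != 0, nonunit z' & nonunit (z / z')].
  have [[z0 nz]|nz] := EM (z != 0 /\ nonunit z); last first.
    by exists 0 => z0 nz'; case: nz.
  apply: contrapT => noz'; apply: nos; exists z; split=> // z' nz'.
  have [->|z'0] := eqVneq z' 0; first by rewrite mul0r.
  apply: contrapT => Az'; apply: noz'; exists z' => _ _; split=> //.
  split=> [|b Ab zb]; first by case: (adm_valuation (z' / z)); rewrite ?invf_div.
  apply: Az'; have -> // : z' / z = b.
  by rewrite -invf_div; apply: (mulfI (_ : z / z' != 0)); rewrite ?divff ?zb // mulf_neq0 ?invr_eq0.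
have [f Hf] := choice step.
have Hx i : iter i f t != 0 /\ nonunit (iter i f t).
  elim: i => [|i [xi nxi]] /=; first by split=> //; apply: nonunit_t.
  by case: (Hf _ xi nxi).
apply: (@no_infinite_chain (fun i => iter i f t)) => // i; have [xi nxi] := Hx i => //.
by case: (Hf _ xi nxi).
Qed.

Variable s : K.
Hypotheses (s0 : s != 0) (ns : nonunit s) (genS : forall z, nonunit z -> A (z / s)).

Definition aunit z := A z /\ A z^-1.

Lemma aunitP z n : z != 0 -> A (z / s ^+ n) -> ~ A (z / s ^+ n.+1) ->
  aunit (z / s ^+ n).
Proof.
move=> z0 Az nAz; split=> //; apply: nonunitPn => //.
  by rewrite mulf_neq0 ?invr_eq0 ?expf_neq0.
by move=> /genS; rewrite -mulrA -invfM -exprSr.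
Qed.

Lemma bounded_unit z : z != 0 -> A z -> (exists n, ~ A (z / s ^+ n)) ->
  exists n, aunit (z / s ^+ n).
Proof.
move=> z0 Az [n0 Hn0].
have /ex_minnP[[|n] /asboolP Hn minn] : exists n, `[< ~ A (z / s ^+ n) >].
  by exists n0; apply/asboolP.
  by case: Hn; rewrite expr0 divr1.
exists n; apply: aunitP => //; apply: contrapT => nA.
have /minn : `[< ~ A (z / s ^+ n) >] by apply/asboolP.
by rewrite ltnn.
Qed.

Lemma aunit_t : exists n, aunit (t / s ^+ n).
Proof.
apply: bounded_unit; rewrite ?At //; apply: contrapT => H.
have Atn n : A (t / s ^+ n) by apply: contrapT => nA; apply: H; exists n.
have shift i : t / s ^+ i = t / s ^+ i.+1 * s.
  by rewrite exprSr invfM mulrA divfK.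
apply: (@no_infinite_chain (fun i => t / s ^+ i)).
- by rewrite expr0 divr1.
- by move=> i; rewrite shift; apply: nonunitM.
- by move=> i; rewrite mulf_neq0 ?invr_eq0 ?expf_neq0.
move=> i; rewrite [X in X / _]shift mulrAC divff ?mul1r //.
by rewrite mulf_neq0 ?invr_eq0 ?expf_neq0.
Qed.

(** A polynomial in t is a power of t times a unit. *)
Lemma ev_divides_power phi : phi != 0 ->
  ev phi != 0 /\ exists r, A (t ^+ r / ev phi).
Proof.
elim/poly_ind: phi => [|p c IHp]; first by rewrite eqxx.
have [->|c0] := eqVneq c 0.
  rewrite addr0 mulf_eq0 negb_or => /andP[/IHp[p0 [r Ar]] _].
  rewrite eval1M eval1X; split; first by rewrite mulf_neq0.
  by exists r.+1; rewrite exprSr -mulf_div divff // mulr1.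
move=> _; rewrite eval1D eval1M eval1X eval1C.
have [|d0 Ad] := @adm_unit1 (- (ev p / iota c)).
  by apply: AN; apply: Amul => //; rewrite -fmorphV; apply: Aconst.
have -> : ev p * t + iota c = (1 - t * - (ev p / iota c)) * iota c.
  by rewrite mulrN opprK mulrDl mul1r mulrA divfK ?fmorph_eq0 // addrC mulrC.
split; first by rewrite mulf_neq0 ?fmorph_eq0.
exists 0%N; rewrite expr0 div1r invfM; apply: Amul => //.
by rewrite -fmorphV; apply: Aconst.
Qed.

(** If z were divisible by all powers of s, so would be the lowest nonzero
    coefficient of an equation of z over F[t], and hence some power of t. *)
Lemma aunit_adm z : z != 0 -> A z -> exists n, aunit (z / s ^+ n).
Proof.
move=> z0 Az; apply: bounded_unit => //; apply: contrapT => H.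
have {}H n : A (z / s ^+ n) by apply: contrapT => nA; apply: H; exists n.
have [phi [[i0 phi0] rel]] := finK (fun i => z ^+ i).
case: (@arg_minnP _ i0 (fun i => phi i != 0) (fun i => i : nat) phi0) => j phij minj.
have [e0 [r Ar]] := ev_divides_power phij.
have Aez : A (ev (phi j) / z).
  have -> : ev (phi j) / z = - \sum_(i < N | i != j) ev (phi i) * z ^+ (i - j).-1.
    apply/eqP; rewrite -addr_eq0; apply/eqP; apply: (mulIf (expf_neq0 j.+1 z0)).
    rewrite mul0r -[RHS]rel [RHS](bigD1 j) //= mulrDl exprS mulrA divfK //; congr (_ + _).
    rewrite mulr_suml; apply: eq_bigr => i ij.
    have [->|/minj ji] := eqVneq (phi i) 0; first by rewrite eval1_0 !mul0r.
    have lt : (j < i)%N by rewrite ltn_neqAle ji eq_sym andbT; apply: contra ij => /eqP/val_inj->.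
    by rewrite -mulrA -exprS -exprD; congr (_ * _ ^+ _); lia.
  by apply: AN; apply: Asum => i _; apply: Amul => //; apply: AX.
have [k [_ Ast]] := aunit_t.
have [_ /(_ s^-1)] := ns; apply; last by rewrite divff.
have -> : s^-1 = (t / s ^+ k)^-1 ^+ r * ((t ^+ r / ev (phi j)) * ((ev (phi j) / z) * (z / s ^+ (k * r).+1))).
  rewrite [ev _ / z * _]mulrA divfK // [t ^+ r / _ * _]mulrA divfK //.
  rewrite invf_div expr_div_n -exprM exprS.
  have := expf_neq0 (k * r) s0; have := expf_neq0 r t0.
  by move: (s ^+ (k * r)) (t ^+ r) => a b b0 a0; field; rewrite s0 a0 b0.
by do !apply: Amul => //; apply: AX.
Qed.

Lemma aunit_exp_eq0 (k : int) : aunit (s ^ k) -> k = 0.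
Proof.
have pos n : ~ A (s ^- n.+1).
  move=> As; have [_ /(_ (s ^+ n * s ^- n.+1))] := ns; apply.
    by apply: Amul => //; apply: AX; case: ns.
  by rewrite mulrA -exprS divff ?expf_neq0.
case: k => [[|n]|n] [Ask AskV] //.
  by case: (pos n).
by case: (pos n).
Qed.

Lemma aunitM z w : aunit z -> aunit w -> aunit (z * w).
Proof. by move=> [? ?] [? ?]; split; rewrite ?invfM; apply: Amul. Qed.

Lemma aunitV z : aunit z -> aunit z^-1.
Proof. by case=> *; split; rewrite ?invrK. Qed.

Lemma aunit_ex z : z != 0 -> exists k : int, aunit (z * s ^ (- k)).
Proof.
move=> z0; have [Az|AzV] := adm_valuation z.
  have [n Hn] := aunit_adm z0 Az; exists n%:Z.
  by rewrite -invr_expz.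
have zV0 : z^-1 != 0 by rewrite invr_eq0.
have [n /aunitV] := aunit_adm zV0 AzV; rewrite invfM !invrK => Hn.
by exists (- n%:Z); rewrite opprK.
Qed.

Definition adic_ord z : int :=
  if z == 0 then 0 else xget 0 [set k : int | aunit (z * s ^ (- k))].

Lemma adic_ordP z : z != 0 -> aunit (z * s ^ (- adic_ord z)).
Proof.
move=> z0; rewrite /adic_ord (negPf z0).
by have := xgetPex 0 (aunit_ex z0).
Qed.

Lemma adic_ord_eq z k : z != 0 -> aunit (z * s ^ (- k)) -> adic_ord z = k.
Proof.
move=> z0 Hk; apply/eqP; rewrite -subr_eq0; apply/eqP/aunit_exp_eq0.
have -> : s ^ (adic_ord z - k) = (z * s ^ (- k)) / (z * s ^ (- adic_ord z)).
  by rewrite -mulf_div divff // mul1r invr_expz opprK expfzDr // mulrC.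
by apply: aunitM => //; apply/aunitV/adic_ordP.
Qed.

Lemma adic_ord_ge0 z : z != 0 -> A z -> 0 <= adic_ord z.
Proof.
move=> z0 Az; have [n Hn] := aunit_adm z0 Az.
by rewrite (@adic_ord_eq _ n%:Z) // -invr_expz.
Qed.

Lemma adic_ordM z w : z != 0 -> w != 0 -> adic_ord (z * w) = adic_ord z + adic_ord w.
Proof.
move=> z0 w0; apply: adic_ord_eq; first by rewrite mulf_neq0.
by rewrite opprD expfzDr // mulrACA; apply: aunitM; apply: adic_ordP.
Qed.

Lemma adic_ordD z w : z != 0 -> w != 0 -> z + w != 0 ->
  Num.min (adic_ord z) (adic_ord w) <= adic_ord (z + w).
Proof.
move=> z0 w0 zw0.
wlog Azw : z w z0 w0 zw0 / A (z / w) => [wl|].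
  have [Azw|] := adm_valuation (z / w); first exact: wl.
  by rewrite invf_div minC addrC => Awz; apply: wl => //; rewrite addrC.
rewrite ge_min; apply/orP; right.
have zwE : z + w = (z / w + 1) * w by rewrite mulrDl divfK // mul1r.
have u0 : z / w + 1 != 0 by apply: contraNneq zw0 => u0; rewrite zwE u0 mul0r.
by rewrite zwE adic_ordM // lerDr; apply: adic_ord_ge0 => //; apply: Aadd.
Qed.

Lemma adic_ord_const c : c != 0 -> adic_ord (iota c) = 0.
Proof.
move=> c0; apply: adic_ord_eq; rewrite ?fmorph_eq0 //= expr0z mulr1.
by split; rewrite -?fmorphV; apply: Aconst.
Qed.

Lemma adic_ord_s : adic_ord s = 1.
Proof. by apply: adic_ord_eq => //; rewrite -invr_expz expr1z divff //; split; rewrite ?invr1. Qed.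

Lemma adic_place : exists P : place iota, 0 < P t.
Proof.
have o0 : adic_ord 0 = 0 by rewrite /adic_ord eqxx.
exists (@Place F K iota adic_ord o0 adic_ordM adic_ordD adic_ord_const 
  (ex_intro _ s adic_ord_s)) => /=.
have -> : t = t / s * s by rewrite divfK.
have ts0 : t / s != 0 by rewrite mulf_neq0 ?invr_eq0.
rewrite adic_ordM // adic_ord_s ltzD1 adic_ord_ge0 //.
by apply: genS; apply: nonunit_t.
Qed.

End PlaceExistence.

(** The last hypothesis says that t is not invertible in F[t]. *)
Theorem zero_exists (F K : fieldType) (iota : {rmorphism F -> K}) (t : K) N :
  finite_over iota t N -> (t != 0)%R ->
  (forall p, t * eval1 iota t p != 1)%R ->
  exists P : place iota, (0 < P t)%R.
Proof.
move=> fin t0 trans; have [A [admA maxA]] := maximal_admissible t0 trans.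
have [s [s0 ns genS]] := uniformizer_exists t0 admA maxA fin.
exact: adic_place genS.
Qed.

(** * Finite degree over a function *)

(** More vectors than coordinates. *)
Lemma linear_dependence (F : fieldType) (I J : finType) (c : I -> J -> F) :
  (#|J| < #|I|)%N -> exists l : I -> F,
    (exists i, l i != 0%R) /\ forall j, (\sum_i l i * c i j = 0)%R.
Proof.
move=> ltJI; pose M := (\matrix_(i < #|I|, j < #|J|) c (enum_val i) (enum_val j))%R.
have ker0 : kermx M != 0%R.
  rewrite -mxrank_eq0 mxrank_ker subn_eq0 -ltnNge.
  exact: leq_ltn_trans (rank_leq_col _) ltJI.
have /rowV0Pn[v /sub_kermxP vM v0] := ker0.
exists (fun i => v ord0 (enum_rank i)); split.
  have /rV0Pn[i vi] := v0; exists (enum_val i); by rewrite enum_valK.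
move=> j; have /rowP/(_ (enum_rank j)) := vM; rewrite !mxE => vMj.
rewrite -[RHS]vMj (reindex (@enum_val I I)) /=; last exact/onW_bij/enum_val_bij.
by apply: eq_bigr => i _; rewrite !mxE enum_valK enum_rankK.
Qed.

Section FiniteDegree.
Local Open Scope ring_scope.
Variables (F K : fieldType) (iota : {rmorphism F -> K}).
Variables (f : {poly {poly F}}) (x y : K) (n : nat).
Hypothesis hK : is_function_field iota f x y.
Hypothesis fmonic : f \is monic.
Hypothesis sf : size f = n.+2.
Notation ev2 := (eval_at iota x y).

(** The space of the sums of x^i p_i(y) with i <= n and deg p_i < B; its
    dimension over F grows linearly with B. *)
Definition bounded B z := exists p : {poly {poly F}},
  [/\ (size p <= n.+1)%N, forall i, (size (p`_i)%R <= B)%N & ev2 p = z].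

Lemma boundedW B B' z : (B <= B')%N -> bounded B z -> bounded B' z.
Proof. by move=> BB' [p [sp cp <-]]; exists p; split=> // i; apply: leq_trans BB'. Qed.

Lemma boundedD B z w : bounded B z -> bounded B w -> bounded B (z + w).
Proof.
move=> [p [sp cp <-]] [q [sq cq <-]]; exists (p + q); split.
- by rewrite (leq_trans (size_polyD _ _)) // geq_max sp.
- by move=> i; rewrite coefD (leq_trans (size_polyD _ _)) // geq_max cp cq.
- by rewrite eval_atD.
Qed.

Lemma boundedMc B z (c : {poly F}) : bounded B z -> bounded (B + size c) (eval1 iota y c * z).
Proof.
move=> [p [sp cp <-]]; exists (c%:P * p); split.
- rewrite mul_polyC; exact: leq_trans (size_scale_leq _ _) sp.
- move=> i; rewrite coefCM (leq_trans (size_polyMleq _ _)) //.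
  by apply: leq_trans (leq_pred _) _; rewrite addnC leq_add2r.
- by rewrite eval_atM eval_atC.
Qed.

(** Reduction of x^(n+1) by the monic equation raises the degrees in y by a
    constant. *)
Lemma boundedMx : exists C, forall B z, bounded B z -> bounded (B + C) (x * z).
Proof.
pose C := (\max_(i < size f) size (f`_i)%R)%N; exists C.
have fC i : (size (f`_i)%R <= C)%N.
  have [lt|ge] := ltnP i (size f).
    exact: (@leq_bigmax _ (fun i : 'I_(size f) => size (f`_i)%R) (Ordinal lt)).
  by rewrite nth_default // size_poly0.
move=> B z [p [sp cp <-]]; exists (p * 'X - (p`_n)%:P * f); split.
- apply/leq_sizeP => j nj; rewrite coefB coefMX coefCM.
  case: j nj => // j; rewrite ltnS leq_eqVlt => /orP[/eqP<-|nj] /=.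
    move/monicP: fmonic; rewrite /lead_coef sf /= => ->.
    by rewrite mulr1 subrr.
  have fj : f`_j.+1 = 0 by rewrite nth_default // sf.
  by rewrite fj (nth_default _ (leq_trans sp nj)) mulr0 subr0.
- move=> i; rewrite coefB coefMX coefCM (leq_trans (size_polyD _ _)) // geq_max.
  apply/andP; split; last first.
    rewrite size_polyN (leq_trans (size_polyMleq _ _)) //.
    by apply: leq_trans (leq_pred _) _; apply: leq_add.
  case: ifP => _; first by rewrite size_poly0.
  by apply: leq_trans (cp _) _; rewrite leq_addr.
- have f0 : ev2 f = 0 by apply/(eval_at_eq0 hK); exists 1; rewrite mul1r.
  by rewrite eval_atD eval_atN !eval_atM eval_atX f0 mulr0 subr0 mulrC.
Qed.

Lemma boundedM g : exists C, forall B z, bounded B z -> bounded (B + C) (ev2 g * z).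
Proof.
have [Cx HCx] := boundedMx.
elim/poly_ind: g => [|g c [C HC]].
  exists 0%N => B z _; exists 0; split; rewrite ?size_poly0 //.
    by move=> i; rewrite coef0 size_poly0.
  by rewrite eval_at0 mul0r.
exists (Cx + C + size c)%N => B z Bz.
rewrite eval_atD eval_atM eval_atX eval_atC mulrDl -mulrA; apply: boundedD.
  apply: (boundedW _ (HC _ _ (HCx _ _ Bz))); lia.
apply: (boundedW _ (boundedMc c Bz)); lia.
Qed.

Lemma boundedMX g C : (forall B z, bounded B z -> bounded (B + C) (ev2 g * z)) ->
  forall k B z, bounded B z -> bounded (B + k * C) (ev2 g ^+ k * z).
Proof.
move=> HC; elim=> [|k IHk] B z Bz; first by rewrite addn0 expr0 mul1r.
by rewrite exprS -mulrA mulSnr addnA; apply/HC/IHk.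
Qed.

Lemma bounded_eval g : exists B, bounded B (ev2 g).
Proof.
have [C HC] := boundedM g; exists (1 + C)%N; rewrite -[ev2 g]mulr1; apply: HC.
exists 1; split; rewrite ?size_poly1 // ?eval_at1 // => i.
by rewrite coef1; case: (i == 0%N); rewrite ?size_poly1 ?size_poly0.
Qed.

(** Let t = a / b.  Multiplication by a or b raises the bound by a constant C,
    so that the products a^k b^(M-k) z_i, k <= M, lie in a space of dimension
    (n+1) (M C + constant), while there are N (M+1) of them.  With
    N = (n+1) C + 1 and M large they are linearly dependent. *)
Lemma function_field_finite t : exists N, finite_over iota t N.
Proof.
have [a [b [b0 ->]]] := eval_at_quotient hK t.
have [Ca HCa] := boundedM a; have [Cb HCb] := boundedM b.
pose C := (Ca + Cb)%N.
have {}HCa : forall B z, bounded B z -> bounded (B + C) (ev2 a * z).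
  move=> B z /HCa; apply: boundedW; lia.
have {}HCb : forall B z, bounded B z -> bounded (B + C) (ev2 b * z).
  move=> B z /HCb; apply: boundedW; lia.
set d := n.+1; pose N := (d * C).+1; exists N => z.
have /choice[g0 Hg0] := fun i => eval_at_quotient hK (z i).
have /choice[h0 Hh] := Hg0.
pose h := \prod_j h0 j.
have h_neq0 : ev2 h != 0.
  by rewrite eval_at_prod; apply/prodf_neq0 => j _; case: (Hh j).
have /choice[B0 HB0] : forall i, exists B, bounded B (z i * ev2 h).
  move=> i; have [hi ->] := Hh i.
  have [B HB] := bounded_eval (g0 i * \prod_(j | j != i) h0 j); exists B.
  by rewrite /h (bigD1 i) //= !eval_atM mulrA divfK // -eval_atM.
pose Bz := (\max_i B0 i)%N.
have {}HB0 i : bounded Bz (z i * ev2 h) by apply: boundedW (HB0 i); apply: leq_bigmax.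
pose M := (d * Bz)%N; pose B := (Bz + M * C)%N.
have /choice[p Hp] : forall ik : 'I_N * 'I_M.+1, exists p : {poly {poly F}},
    [/\ (size p <= d)%N, forall i, (size (p`_i)%R <= B)%N &
      ev2 p = ev2 a ^+ ik.2 * (ev2 b ^+ (M - ik.2) * (z ik.1 * ev2 h))].
  move=> [i k]; have := boundedMX HCa k (boundedMX HCb (M - k) (HB0 i)).
  have -> : (Bz + (M - k) * C + k * C = B)%N by have := ltn_ord k; rewrite /B; nia.
  by [].
pose c (ik : 'I_N * 'I_M.+1) (ij : 'I_d * 'I_B) := (p ik)`_(ij.1)`_(ij.2).
have [|l [[[i0 k0] l0] Hl]] := @linear_dependence F _ _ c.
  by rewrite !card_prod !card_ord /N /B /M; nia.
exists (fun i => \poly_(k < M.+1) l (i, inord k)); split.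
  exists i0; apply: contraNneq l0 => /(congr1 (fun q : {poly F} => q`_k0)).
  by rewrite coef_poly ltn_ord inord_val coef0 => ->.
have lp0 : \sum_ik (l ik)%:P%:P * p ik = 0.
  apply/polyP => i; rewrite coef0 coef_sum; apply/polyP => j.
  rewrite coef0 coef_sum.
  under eq_bigr => ik _ do rewrite coefCM coefCM.
  have [lti|gei] := ltnP i d; last first.
    rewrite big1 // => ik _; have [sp _ _] := Hp ik.
    by rewrite (nth_default _ (leq_trans sp gei)) coef0 mulr0.
  have [ltj|gej] := ltnP j B; last first.
    rewrite big1 // => ik _; have [_ cp _] := Hp ik.
    by rewrite (nth_default _ (leq_trans (cp i) gej)) mulr0.
  exact: (Hl (Ordinal lti, Ordinal ltj)).
have bM0 : ev2 b ^+ M * ev2 h != 0 by rewrite mulf_neq0 ?expf_neq0.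
apply: (mulIf bM0); rewrite mul0r.
rewrite -[RHS](eval_at0 iota x y) -[in RHS]lp0 eval_at_sum.
transitivity (\sum_i \sum_k ev2 ((l (i, k))%:P%:P * p (i, k))); last first.
  by rewrite pair_big /=; apply: eq_bigr => -[i k] _.
rewrite mulr_suml.
apply: eq_bigr => i _; rewrite /eval1.
have sz : (size (map_poly iota (\poly_(k < M.+1) l (i, inord k))) <= M.+1)%N.
  by rewrite size_map_poly size_poly.
rewrite (horner_coef_wide _ sz) !mulr_suml; apply: eq_bigr => k _.
rewrite coef_map /= coef_poly ltn_ord inord_val eval_atM !eval_atC eval1C.
have [_ _ ->] /= := Hp (i, k).
rewrite -!mulrA; congr (_ * _); rewrite expr_div_n -mulrA; congr (_ * _).
have -> : ev2 b ^+ M = ev2 b ^+ (M - k) * ev2 b ^+ k.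
  by rewrite -exprD subnK // -ltnS.
have := expf_neq0 k b0; move: (ev2 b ^+ k) (ev2 b ^+ (M - k)) => u v u0.
by field.
Qed.

End FiniteDegree.

(** * Kummer extensions of a rational function field *)

Section RationalFunctions.
Local Open Scope ring_scope.
Variables (F K : fieldType) (iota : {rmorphism F -> K}) (u : K).
Notation ev := (eval1 iota u).
Hypothesis trans_u : forall p : {poly F}, p != 0 -> ev p != 0.

Definition ratfun a := exists p q : {poly F}, q != 0 /\ a = ev p / ev q.

Lemma ratfun_eval p : ratfun (ev p).
Proof. by exists p, 1; rewrite oner_neq0 eval1_1 divr1. Qed.

Lemma ratfun_const c : ratfun (iota c).
Proof. by rewrite -(eval1C iota u); apply: ratfun_eval. Qed.

Lemma ratfun0 : ratfun 0. Proof. by rewrite -(rmorph0 iota); apply: ratfun_const. Qed.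
Lemma ratfun1 : ratfun 1. Proof. by rewrite -(rmorph1 iota); apply: ratfun_const. Qed.

Lemma ratfunD a b : ratfun a -> ratfun b -> ratfun (a + b).
Proof.
move=> [p [q [q0 ->]]] [p' [q' [q'0 ->]]]; exists (p * q' + p' * q), (q * q').
by rewrite mulf_neq0 // eval1D !eval1M addf_div ?trans_u.
Qed.

Lemma ratfunM a b : ratfun a -> ratfun b -> ratfun (a * b).
Proof.
move=> [p [q [q0 ->]]] [p' [q' [q'0 ->]]]; exists (p * p'), (q * q').
by rewrite mulf_neq0 // !eval1M mulf_div.
Qed.

Lemma ratfunV a : ratfun a -> ratfun a^-1.
Proof.
move=> [p [q [q0 ->]]]; rewrite invf_div; have [->|p0] := eqVneq p 0.
  by rewrite eval1_0 invr0 mulr0; apply: ratfun0.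
by exists q, p.
Qed.

Lemma ratfun_fixed (s : {rmorphism K -> K}) a :
  (forall c, s (iota c) = iota c) -> s u = u -> ratfun a -> s a = a.
Proof.
move=> sc su; have sev p : s (ev p) = ev p.
  elim/poly_ind: p => [|p c IHp]; first by rewrite eval1_0 rmorph0.
  by rewrite eval1D eval1M eval1X eval1C rmorphD rmorphM IHp su sc.
by move=> [p [q [_ ->]]]; rewrite fmorph_div !sev.
Qed.

Lemma ratfun_coprime a : ratfun a ->
  exists p q : {poly F}, [/\ q != 0, coprimep p q & a = ev p / ev q].
Proof.
move=> [p [q [q0 ->]]].
have g0 : gcdp p q != 0 by rewrite gcdp_eq0 negb_and q0 orbT.
exists (p %/ gcdp p q), (q %/ gcdp p q); split.
- by rewrite dvdp_div_eq0 // dvdp_gcdr.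
- by rewrite coprimep_div_gcd // q0 orbT.
- have pE : ev p = ev (p %/ gcdp p q) * ev (gcdp p q).
    by rewrite -eval1M divpK ?dvdp_gcdl.
  have qE : ev q = ev (q %/ gcdp p q) * ev (gcdp p q).
    by rewrite -eval1M divpK ?dvdp_gcdr.
  by rewrite pE qE -mulf_div divff ?mulr1 // trans_u.
Qed.
End RationalFunctions.

Section KummerDecomposition.
Local Open Scope ring_scope.
Variables (F K : fieldType) (iota : {rmorphism F -> K}) (u y : K) (n : nat).
Notation D := n.+1.
Notation ev := (eval1 iota u).
Notation ratfun := (ratfun iota u).
Hypothesis trans_u : forall p : {poly F}, p != 0 -> ev p != 0.
Hypothesis yD : ratfun (y ^+ D).
Hypothesis gen : forall z : K, exists g h : {poly {poly F}},
  eval_at iota y u h != 0 /\ z = eval_at iota y u g / eval_at iota y u h.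
Variables (zeta : F).
Hypothesis zetaP : D.-primitive_root zeta.
Hypothesis D0 : D%:R != 0 :> F.
Variable sigma : nat -> {rmorphism K -> K}.
Hypothesis sigma_const : forall i c, sigma i (iota c) = iota c.
Hypothesis sigma_u : forall i, sigma i u = u.
Hypothesis sigma_y : forall i, sigma i y = iota (zeta ^+ i) * y.

(** The automorphisms sigma_i : y -> zeta^i y generate the Galois group of the
    extension, and the components of this expansion are its eigenvectors. *)
Definition expansion (a : nat -> K) := \sum_(j < D) a j * y ^+ j.
Definition expandable z := exists2 a, (forall j, ratfun (a j)) & z = expansion a.

Lemma expandable_ratfun c : ratfun c -> expandable c.
Proof.
move=> rc; exists (fun j => if j == 0%N then c else 0).
  by case=> //= j; apply: ratfun0.
rewrite /expansion big_ord_recl /= expr0 mulr1 big1 ?addr0 // => i _.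
by rewrite mul0r.
Qed.

Lemma expandableD z w : expandable z -> expandable w -> expandable (z + w).
Proof.
move=> [a ra ->] [b rb ->]; exists (fun j => a j + b j).
  by move=> j; apply: ratfunD.
by rewrite /expansion -big_split; apply: eq_bigr => i _; rewrite mulrDl.
Qed.

Lemma expandableZ c z : ratfun c -> expandable z -> expandable (c * z).
Proof.
move=> rc [a ra ->]; exists (fun j => c * a j).
  by move=> j; apply: ratfunM.
by rewrite /expansion mulr_sumr; apply: eq_bigr => i _; rewrite mulrA.
Qed.

Lemma expandableMy z : expandable z -> expandable (y * z).
Proof.
move=> [a ra ->]; exists (fun j => if j is j'.+1 then a j' else a n * y ^+ D).
  by case=> [|j]; [apply: ratfunM | apply: ra].
rewrite /expansion mulr_sumr big_ord_recr big_ord_recl /= addrC; congr (_ + _).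
  by rewrite expr0 mulr1 mulrCA -exprS.
by apply: eq_bigr => i _; rewrite mulrCA -exprS.
Qed.

Lemma expandable_sum (I : Type) (r : seq I) (P : pred I) (G : I -> K) :
  (forall i, P i -> expandable (G i)) -> expandable (\sum_(i <- r | P i) G i).
Proof.
move=> eG; elim/big_ind: _ => //; last exact: expandableD.
exact/expandable_ratfun/ratfun0.
Qed.

Lemma expandableM z w : expandable z -> expandable w -> expandable (z * w).
Proof.
move=> [a ra ->] ew; rewrite /expansion mulr_suml; apply: expandable_sum => i _.
rewrite -mulrA; apply: expandableZ => //.
elim: (i : nat) => [|j IHj]; first by rewrite expr0 mul1r.
by rewrite exprS -mulrA; apply: expandableMy.
Qed.

Lemma expandable_prod (I : Type) (r : seq I) (P : pred I) (G : I -> K) :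
  (forall i, P i -> expandable (G i)) -> expandable (\prod_(i <- r | P i) G i).
Proof.
move=> eG; elim/big_ind: _ => //; last exact: expandableM.
exact/expandable_ratfun/ratfun1.
Qed.

Lemma expandable_eval g : expandable (eval_at iota y u g).
Proof.
elim/poly_ind: g => [|g c IHg].
  by rewrite eval_at0; apply/expandable_ratfun/ratfun0.
rewrite eval_atD eval_atM eval_atX eval_atC mulrC; apply: expandableD.
  exact: expandableMy.
exact/expandable_ratfun/ratfun_eval.
Qed.

Lemma sigma_expansion i a : (forall j, ratfun (a j)) ->
  sigma i (expansion a) = expansion (fun j => iota (zeta ^+ (i * j)) * a j).
Proof.
move=> ra; rewrite /expansion rmorph_sum; apply: eq_bigr => j _.
rewrite rmorphM rmorphXn sigma_y exprMn -rmorphXn -exprM /=.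
by rewrite (ratfun_fixed (sigma_const i) (sigma_u i)) // mulrCA mulrA.
Qed.

Lemma expandable_sigma i z : expandable z -> expandable (sigma i z).
Proof.
move=> [a ra ->]; rewrite sigma_expansion //.
exists (fun j => iota (zeta ^+ (i * j)) * a j) => // j.
by apply: ratfunM => //; apply: ratfun_const.
Qed.

Lemma sigma_add i k z : sigma (i + k) z = sigma i (sigma k z).
Proof.
have fixev p l : sigma l (ev p) = ev p.
  by apply: ratfun_fixed; rewrite //; apply: ratfun_eval.
have E g : sigma (i + k) (eval_at iota y u g) = sigma i (sigma k (eval_at iota y u g)).
  elim/poly_ind: g => [|g c IHg]; first by rewrite eval_at0 !rmorph0.
  rewrite eval_atD eval_atM eval_atX eval_atC !rmorphD !rmorphM IHg !fixev.
  congr (_ * _ + _); rewrite !sigma_y rmorphM sigma_const sigma_y mulrA -rmorphM.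
  by rewrite -exprD addnC.
by have [g [h [_ ->]]] := gen z; rewrite !fmorph_div !E.
Qed.

Lemma sigma_period i z : sigma (D + i) z = sigma i z.
Proof.
have fixev p l : sigma l (ev p) = ev p.
  by apply: ratfun_fixed; rewrite //; apply: ratfun_eval.
have E g : sigma (D + i) (eval_at iota y u g) = sigma i (eval_at iota y u g).
  elim/poly_ind: g => [|g c IHg]; first by rewrite eval_at0 !rmorph0.
  rewrite eval_atD eval_atM eval_atX eval_atC !rmorphD !rmorphM IHg !fixev.
  by congr (_ * _ + _); rewrite !sigma_y exprD (prim_expr_order zetaP) mul1r.
by have [g [h [_ ->]]] := gen z; rewrite !fmorph_div !E.
Qed.

(** The projection to the eigenspace of y^j; the exponent D - j stands for -j,
    as zeta^D = 1. *)
Definition component j z :=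
  iota D%:R^-1 * \sum_(i < D) iota (zeta ^+ (i * (D - j))) * sigma i z.

Lemma component_expansion a j : (forall j, ratfun (a j)) -> (j < D)%N ->
  component j (expansion a) = a j * y ^+ j.
Proof.
move=> ra ltj; rewrite /component.
under eq_bigr => i _ do rewrite sigma_expansion // /expansion mulr_sumr.
rewrite exchange_big /= (bigD1 (Ordinal ltj)) //= [X in _ + X]big1 ?addr0.
  rewrite (eq_bigr (fun => a j * y ^+ j)) => [|i _].
    rewrite sumr_const card_ord -[X in _ * X]mulr_natl mulrA -(rmorph_nat iota).
    by rewrite -rmorphM mulVf // rmorph1 mul1r.
  rewrite !mulrA -rmorphM -exprD -mulnDr subnK 1?ltnW // mulnC exprM.
  by rewrite (prim_expr_order zetaP) expr1n rmorph1 mul1r.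
move=> k kj; pose w := zeta ^+ (D - j + k).
rewrite (eq_bigr (fun i : 'I_D => iota (w ^+ i) * (a k * y ^+ k))) => [|i _]; last first.
  by rewrite !mulrA -rmorphM -exprD -mulnDr mulnC exprM.
rewrite -mulr_suml -rmorph_sum; suff -> : \sum_(i < D) w ^+ i = 0 by rewrite rmorph0 mul0r.
have w1 : w - 1 != 0.
  rewrite subr_eq0 -(prim_order_dvd zetaP); apply: contra kj.
  move=> /dvdnP[m mE]; apply/eqP/val_inj => /=; have := ltn_ord k.
  by case: m mE => [|[|m]]; nia.
apply: (mulfI w1); rewrite mulr0 -subrX1 -exprM mulnC exprM.
by rewrite (prim_expr_order zetaP) expr1n subrr.
Qed.

Lemma sigma0 z : sigma 0 z = z.
Proof.
apply: (fmorph_inj (sigma 0)).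
by rewrite -sigma_add.
Qed.

Definition sigma_norm z := \prod_(i < D) sigma i z.

Lemma sigma_norm_fixed k z : sigma k (sigma_norm z) = sigma_norm z.
Proof.
have fix1 w : sigma 1 (sigma_norm w) = sigma_norm w.
  rewrite /sigma_norm rmorph_prod [RHS]big_ord_recl big_ord_recr /= mulrC.
  congr (_ * _); last by apply: eq_bigr => i _; rewrite -sigma_add.
  by rewrite -sigma_add add1n -[n.+1]addn0 sigma_period.
elim: k => [|k IHk]; first exact: sigma0.
by rewrite -addn1 sigma_add fix1.
Qed.

(** The norm is fixed by the Galois group, so that it is equal to its own
    component of index 0. *)
Lemma sigma_norm_ratfun z : expandable z -> ratfun (sigma_norm z).
Proof.
move=> ez; have [a ra Na] : expandable (sigma_norm z).
  by apply: expandable_prod => i _; apply: expandable_sigma.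
suff -> : sigma_norm z = a 0%N by [].
have := component_expansion ra (ltn0Sn n); rewrite -Na expr0 mulr1 => <-.
rewrite /component (eq_bigr (fun => sigma_norm z)) => [|i _].
  rewrite sumr_const card_ord -[X in _ * X]mulr_natl mulrA -(rmorph_nat iota).
  by rewrite -rmorphM mulVf // rmorph1 mul1r.
by rewrite sigma_norm_fixed subn0 mulnC exprM (prim_expr_order zetaP) expr1n rmorph1 mul1r.
Qed.

(** Denominators are made rational by multiplication with their conjugates. *)
Theorem kummer_expansion z : expandable z.
Proof.
have [g [h [h0 ->]]] := gen z.
have nh0 : sigma_norm (eval_at iota y u h) != 0.
  by apply/prodf_neq0 => i _; rewrite fmorph_eq0.
have -> : eval_at iota y u g / eval_at iota y u h =
    (sigma_norm (eval_at iota y u h))^-1 *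
    (eval_at iota y u g * \prod_(i < n) sigma i.+1 (eval_at iota y u h)).
  apply: (mulfI nh0); rewrite [RHS]mulVKf // /sigma_norm big_ord_recl sigma0 /=.
  by rewrite mulrC mulrACA -[LHS]mulrA mulrCA mulrC; field.
apply: expandableZ; first by apply/ratfunV/sigma_norm_ratfun/expandable_eval.
apply: expandableM; first exact: expandable_eval.
by apply: expandable_prod => i _; apply/expandable_sigma/expandable_eval.
Qed.

End KummerDecomposition.

(** * Orders of rational functions of one variable *)

Section EvalOrders.
Local Open Scope ring_scope.
Variables (F K : fieldType) (iota : {rmorphism F -> K}) (u : K).
Notation ev := (eval1 iota u).
Hypothesis trans_u : forall p : {poly F}, p != 0 -> ev p != 0.
Implicit Type R : place iota.

Let u0 : u != 0.
Proof. by have := trans_u (negbT (polyX_eq0 F)); rewrite eval1X. Qed.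

Lemma ord_eval_neg R (p : {poly F}) : R u < 0 -> p != 0 -> R (ev p) = (size p).-1%:Z * R u.
Proof.
move=> Ru; elim/poly_ind: p => [|p c IHp]; first by rewrite eqxx.
have [->|p0 _] := eqVneq p 0.
  rewrite mul0r add0r polyC_eq0 => c0.
  by rewrite eval1C place_ord_const // size_polyC c0 mul0r.
have sz : size (p * 'X + c%:P) = (size p).+1.
  by rewrite size_MXaddC (negPf p0).
have pu0 : ev p * u != 0 by rewrite mulf_neq0 ?trans_u.
have Rpu : R (ev p * u) = (size p)%:Z * R u.
  rewrite place_ordM ?trans_u // IHp //.
  by have := size_poly_gt0 p; rewrite p0; case: (size p) => // m _ /=; lia.
rewrite sz /= eval1D eval1M eval1X eval1C -Rpu.
apply: (proj2 (ordD_lt pu0 _ (ord_ge_const R c))).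
by rewrite Rpu; have := size_poly_gt0 p; rewrite p0; nia.
Qed.

Lemma ord_eval_ge0 R (p : {poly F}) : 0 <= R u -> ord_ge R 0 (ev p).
Proof.
move=> Ru; elim/poly_ind: p => [|p c IHp]; first by rewrite eval1_0 ord_ge0.
rewrite eval1D eval1M eval1X eval1C; apply: ord_geD; last exact: ord_ge_const.
by rewrite -[0]addr0; apply: ord_geM => //; rewrite ord_geE.
Qed.

(** At a place where u is regular, a Bezout relation excludes common zeros. *)
Lemma ord_eval_coprime R (p q : {poly F}) : coprimep p q -> 0 <= R u -> 0 < R (ev p) ->
  R (ev q) = 0.
Proof.
move=> /Bezout_eq1_coprimepP[[a b] /= ab1] Ru Rp.
have q0 : q != 0.
  apply: contraTneq Rp => q0; move: ab1; rewrite q0 mulr0 addr0 => ap1.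
  have p0 : p != 0 by apply: contra_eq_neq ap1 => ->; rewrite mulr0 eq_sym oner_eq0.
  have a0 : a != 0 by apply: contra_eq_neq ap1 => ->; rewrite mul0r eq_sym oner_eq0.
  have := place_ord1 R; rewrite -(eval1_1 iota u) -ap1 eval1M place_ordM ?trans_u //.
  have := ord_eval_ge0 a Ru; rewrite ord_geE ?trans_u //; lia.
have Rq : 0 <= R (ev q) by have := ord_eval_ge0 q Ru; rewrite ord_geE ?trans_u.
apply/eqP; rewrite eq_le Rq andbT leNgt; apply/negP => Rq0.
suff : ord_ge R 1 1 by rewrite ord_geE ?oner_neq0 // place_ord1.
rewrite -(eval1_1 iota u) -ab1 eval1D !eval1M -[X in ord_ge _ X _](add0r 1).
by apply: ord_geD; apply: ord_geM; rewrite ?ord_eval_ge0 // /ord_ge -gtz0_ge1 ?Rp ?Rq0 orbT.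
Qed.

Lemma ord_eval_pos R (p : {poly F}) : 0 < R u -> p`_0 != 0 -> R (ev p) = 0.
Proof.
move=> Ru p0; apply: (@ord_eval_coprime _ 'X); rewrite ?eval1X ?ltW //.
by rewrite coprimep_sym -[X in coprimep _ X]subr0 coprimep_XsubC rootE horner_coef0.
Qed.

Lemma ord_eval_le_size R (p : {poly F}) : 0 < R u -> p != 0 -> R (ev p) <= (size p).-1%:Z * R u.
Proof.
move=> Ru; elim/poly_ind: p => [|p c IHp]; first by rewrite eqxx.
have [->|c0] := eqVneq c 0.
  rewrite addr0 => pX0; have p0 : p != 0 by apply: contraNneq pX0 => ->; rewrite mul0r.
  rewrite size_mulX // eval1M eval1X place_ordM ?trans_u //=.
  by have := IHp p0; have := size_poly_gt0 p; rewrite p0; case: (size p) => // m _ /=; lia.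
move=> _; rewrite ord_eval_pos ?coefD ?coefMX ?coefC ?add0r //=.
by apply: mulr_ge0 => //; apply: ltW.
Qed.

Lemma ratfun_degree a : ratfun iota u a -> a != 0 ->
  exists m : int, forall R, R u < 0 -> R a = m * R u.
Proof.
move=> [p [q [q0 ->]]] a0.
have p0 : p != 0 by apply: contraNneq a0 => ->; rewrite eval1_0 mul0r.
exists ((size p).-1%:Z - (size q).-1%:Z) => R Ru.
by rewrite ord_div ?trans_u // !ord_eval_neg // mulrBl.
Qed.

(** The constant is the ratio of the leading coefficients when the degrees of
    the numerator and of the denominator agree, and 0 otherwise. *)
Lemma ratfun_residue R a : R u < 0 -> ratfun iota u a -> ord_ge R 0 a ->
  exists c, ord_ge R 1 (a - iota c).
Proof.
move=> Ru [p [q [q0 ->]]] a0.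
have spq : (size p <= size q)%N.
  have [->|p0] := eqVneq p 0; first by rewrite size_poly0.
  move: a0; rewrite ord_geE ?mulf_neq0 ?invr_eq0 ?trans_u //.
  rewrite ord_div ?trans_u // !ord_eval_neg //.
  have := size_poly_gt0 p; have := size_poly_gt0 q; rewrite p0 q0.
  by case: (size p) (size q) => [|sp] [|sq] //= _ _; nia.
pose c := p`_(size q).-1 / lead_coef q; exists c.
have -> : ev p / ev q - iota c = ev (p - c *: q) / ev q.
  rewrite -mul_polyC eval1D eval1N eval1M eval1C mulrBl mulfK ?trans_u //.
have [->|d0] := eqVneq (p - c *: q) 0; first by rewrite eval1_0 mul0r ord_ge0.
have sd : (size (p - c *: q)%R < size q)%N.
  rewrite -(prednK (_ : 0 < size q)%N) ?size_poly_gt0 // ltnS.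
  apply/leq_sizeP => j; rewrite leq_eqVlt => /orP[/eqP<-|lt].
    by rewrite coefB coefZ /c -[q`__]/(lead_coef q) divfK ?subrr // lead_coef_eq0.
  have sqj : (size q <= j)%N by lia.
  by rewrite coefB coefZ !nth_default ?mulr0 ?subr0 // (leq_trans spq).
rewrite ord_geE ?mulf_neq0 ?invr_eq0 ?trans_u // ord_div ?trans_u //.
rewrite !ord_eval_neg //; move: sd (size_poly_gt0 (p - c *: q)); rewrite d0.
by case: (size _) (size q) => [|sp] [|sq] //= ? _; nia.
Qed.

End EvalOrders.

(** * Places of the covering 4 i u^2 y^D = u^4 - 1 *)

(** This separates the orders D m + 2 j for different j < D. *)
Lemma parity_bound (k : nat) (m d : int) : ((2 * k).+1%:Z * m = 2 * d ->
  `|d| < (2 * k).+1%:Z -> d = 0)%R.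
Proof.
move=> E dk; have [?|[?|[?|[?|?]]]] :
    (m = 0 \/ m = 1 \/ m = -1 \/ 2 <= m \/ m <= -2)%R by lia.
- subst; lia.
- subst; lia.
- subst; lia.
- nia.
- nia.
Qed.

(** If D V = 2 U with D = 2 k + 1, then e = U - k V satisfies V = 2 e and
    U = D e. *)
Lemma odd_ratio (k : nat) (U V : int) : ((2 * k).+1%:Z * V = 2 * U ->
  V = 2 * (U - k%:Z * V) /\ U = (2 * k).+1%:Z * (U - k%:Z * V))%R.
Proof. by move=> E; split; nia. Qed.

Section KummerPlaces.
Local Open Scope ring_scope.
Variables (F K : fieldType) (iota : {rmorphism F -> K}) (u y : K) (k : nat).
Notation D := (2 * k).+1.
Notation ev := (eval1 iota u).
Hypothesis trans_u : forall p : {poly F}, p != 0 -> ev p != 0.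
Variable kappa : F.
Hypothesis kappa0 : kappa != 0.
Hypothesis rel : iota kappa * u ^+ 2 * y ^+ D = u ^+ 4 - 1.
Hypothesis gen : forall z : K, exists g h : {poly {poly F}},
  eval_at iota y u h != 0 /\ z = eval_at iota y u g / eval_at iota y u h.
Variables (zeta : F).
Hypothesis zetaP : D.-primitive_root zeta.
Hypothesis D0 : D%:R != 0 :> F.
Hypothesis four0 : 4%:R != 0 :> F.
Variable sigma : nat -> {rmorphism K -> K}.
Hypothesis sigma_const : forall i c, sigma i (iota c) = iota c.
Hypothesis sigma_u : forall i, sigma i u = u.
Hypothesis sigma_y : forall i, sigma i y = iota (zeta ^+ i) * y.
Hypothesis finK : forall t, exists N, finite_over iota t N.
Implicit Type R : place iota.

Let u0 : u != 0.
Proof. by have := trans_u (negbT (polyX_eq0 F)); rewrite eval1X. Qed.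

Let ev4 : ev ('X^4 - 1) = u ^+ 4 - 1.
Proof. by rewrite eval1D eval1N eval1_exp eval1X eval1_1. Qed.

Let X4_neq0 : 'X^4 - 1 != 0 :> {poly F}.
Proof. by rewrite -size_poly_gt0 size_XnsubC. Qed.

Let y0 : y != 0.
Proof.
have := trans_u X4_neq0; rewrite ev4 -rel; apply: contraNneq => ->.
by rewrite expr0n mulr0.
Qed.

Let yD : ratfun iota u (y ^+ D).
Proof.
have -> : y ^+ D = ev ('X^4 - 1) / ev (kappa%:P * 'X^2).
  by rewrite ev4 -rel eval1M eval1C eval1_exp eval1X mulrC mulKf // mulf_neq0 ?fmorph_eq0 ?expf_neq0.
by exists ('X^4 - 1), (kappa%:P * 'X^2); rewrite mulf_neq0 ?polyC_eq0 ?expf_neq0 ?polyX_eq0.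
Qed.

Lemma ord_y R : D%:Z * R y = R (ev ('X^4 - 1)) - 2 * R u.
Proof.
have := place_ordZ R (u ^+ 2 * y ^+ D) kappa0; rewrite mulrA rel -ev4 => ->.
by rewrite place_ordM ?expf_neq0 // !place_ordX addrC addKr.
Qed.

(** The number e turns out to be 1; see [ord_infinity]. *)
Lemma ord_at_infinity R : R u < 0 -> 
  exists2 e : int, 0 < e & R u = - (D%:Z * e) /\ R y = - (2 * e).
Proof.
move=> Ru; have := ord_y R; rewrite ord_eval_neg // size_XnsubC //= -mulrBl.
move=> /odd_ratio[VE UE]; exists (k%:Z * R y - R u).
  by rewrite UE pmulr_rlt0 // in Ru; rewrite -opprB oppr_gt0.
by rewrite -opprB !mulrN !opprK.
Qed.

Lemma ord_y_zero R : 0 < R u -> 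
  exists2 e : int, 0 < e & R u = D%:Z * e /\ R y = - (2 * e).
Proof.
move=> Ru; have := ord_y R; rewrite ord_eval_pos //; last first.
  by rewrite coefB coefXn coef1 sub0r oppr_eq0 oner_neq0.
rewrite sub0r -mulrN => Dy.
have /odd_ratio[VE UE] : D%:Z * - R y = 2 * R u by rewrite mulrN Dy mulrN opprK.
exists (R u - k%:Z * - R y); first by rewrite UE pmulr_rgt0 in Ru.
by rewrite -VE opprK.
Qed.

Lemma ord_y_ge0 R : R u = 0 -> 0 <= R y.
Proof.
move=> Ru; have := ord_y R; rewrite Ru.
have Ru0 : 0 <= R u by rewrite Ru.
have := ord_eval_ge0 trans_u ('X^4 - 1) Ru0.
by rewrite ord_geE ?trans_u //; clear; nia.
Qed.

Lemma expand z : exists2 a : nat -> K, (forall j, ratfun iota u (a j)) &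
  z = \sum_(j < D) a j * y ^+ j.
Proof. by have [a ra zE] := kummer_expansion trans_u yD gen zetaP D0 sigma_const sigma_u sigma_y z; exists a. Qed.

(** At the places at infinity, the nonzero terms have pairwise different
    orders, because these differ modulo D.  So the order of a sum is the order
    of the dominant term, and up to normalization it does not depend on the
    place. *)
Lemma dominant_term (a : nat -> K) : (forall j, ratfun iota u (a j)) ->
  \sum_(j < D) a j * y ^+ j != 0 ->
  exists (j : 'I_D) (tau : int), a j != 0 /\
    forall R, R u < 0 -> 
      [/\ R (\sum_(j < D) a j * y ^+ j) = R (a j * y ^+ j),
          D%:Z * R (a j * y ^+ j) = tau * R u
        & forall i : 'I_D, ord_ge R (R (a j * y ^+ j)) (a i * y ^+ i)].
Proof.
move=> ra z0.
have /choice[m Hm] : forall j : 'I_D, exists m : int, a j != 0 ->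
    forall R, R u < 0 -> R (a j) = m * R u.
  move=> j; have [aj0|aj0] := eqVneq (a j) 0; first by exists 0.
  by have [m Hm] := ratfun_degree trans_u (ra j) aj0; exists m.
pose tau (j : 'I_D) : int := D%:Z * m j + 2 * j%:Z.
have ord_term R (e : int) (j : 'I_D) : R u = - (D%:Z * e) -> R y = - (2 * e) -> a j != 0 ->
    0 < e -> R (a j * y ^+ j) = - (e * tau j).
  move=> Ru Ry aj0 e0; rewrite place_ordM ?expf_neq0 // place_ordX (Hm j aj0 R) Ru ?Ry.
    by rewrite /tau; ring.
  by rewrite oppr_lt0 mulr_gt0.
have tau_inj (i j : 'I_D) : tau i = tau j -> i = j.
  move=> tij; apply/val_inj => /=; have := ltn_ord i; have := ltn_ord j.
  move: tij; rewrite /tau; move: (m i) (m j) (i : nat) (j : nat) => mi mj i' j'.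
  clear=> E li lj; have E' : D%:Z * (mi - mj) = 2 * (j'%:Z - i'%:Z) by lia.
  have := parity_bound E'; lia.
have [j1 aj1] : exists j : 'I_D, a j != 0.
  case: (pickP (fun j : 'I_D => a j != 0)) => [j aj|a0]; first by exists j.
  by move: z0; rewrite big1 ?eqxx // => j _; move/negbFE/eqP: (a0 j) => ->; rewrite mul0r.
case: (@arg_maxP _ _ _ j1 (fun j => a j != 0) tau aj1) => j aj0 maxj.
exists j, (tau j); split=> // R Ru.
have [e e0 [RuE RyE]] := ord_at_infinity Ru.
have Rj := ord_term R e j RuE RyE aj0 e0.
have tj0 : a j * y ^+ j != 0 by rewrite mulf_neq0 ?expf_neq0.
have lt_term (i : 'I_D) : i != j -> ord_ge R (R (a j * y ^+ j) + 1) (a i * y ^+ i).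
  move=> ij; have [ai0|ai0] := eqVneq (a i) 0; first by rewrite ai0 mul0r ord_ge0.
  rewrite ord_geE ?mulf_neq0 ?expf_neq0 // Rj (ord_term R e i RuE RyE ai0 e0).
  rewrite lezD1 ltrN2 ltr_pM2l // lt_neqAle; apply/andP; split; last exact: maxj.
  by apply: contra ij => /eqP/tau_inj->.
split.
- rewrite (bigD1 j) //=; apply: (proj2 (ordD_lt tj0 (n := R (a j * y ^+ j) + 1) _ _)).
    by rewrite ltzD1.
  by apply: ord_ge_sum => i ij; apply: lt_term.
- by rewrite Rj RuE; ring.
- move=> i; have [->|ij] := eqVneq i j; first by rewrite ord_geE.
  by apply: ord_ge_le (lt_term i ij); rewrite lerDl.
Qed.

(** All orders are multiples of e, and a uniformizer has order 1. *)
Lemma ord_infinity R : R u < 0 -> R u = - D%:Z /\ R y = - 2.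
Proof.
move=> Ru; have [t Rt] := place_uniformizer R.
have t0 : t != 0 by apply: contra_eq_neq Rt => ->; rewrite place_ord0.
have [a ra tE] := expand t; rewrite tE in t0 Rt.
have [j [tau [_ /(_ R Ru)[Rsum Rj _]]]] := dominant_term ra t0.
have [e e0 [RuE RyE]] := ord_at_infinity Ru.
have e1 : e = 1.
  move: Rj e0; rewrite -Rsum Rt RuE mulr1; clear=> E e0.
  have E1 : tau * e = - 1 by nia.
  have tau_neg : tau <= -1 by nia.
  have [//|e2] : e = 1 \/ 2 <= e by lia.
  nia.
by rewrite RuE RyE e1 !mulr1.
Qed.

Lemma infinity_unique R R' : R u < 0 -> R' u < 0 -> R =1 R'.
Proof.
move=> Ru Ru' z; have [->|z0] := eqVneq z 0; first by rewrite !place_ord0.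
have [a ra zE] := expand z; rewrite zE in z0 *.
have [j [tau [_ Hj]]] := dominant_term ra z0.
have [-> Rj _] := Hj R Ru; have [-> Rj' _] := Hj R' Ru'.
have [RuE _] := ord_infinity Ru; have [RuE' _] := ord_infinity Ru'.
apply: (@mulfI _ D%:Z) => //.
by rewrite Rj Rj' RuE RuE'.
Qed.

Lemma infinity_rational R : R u < 0 -> rational_place R.
Proof.
move=> Ru z z0 Rz; have [RuE RyE] := ord_infinity Ru.
have [a ra zE] := expand z; rewrite zE in z0 Rz *.
have [j [tau [_ /(_ R Ru)[Rsum _ Rge]]]] := dominant_term ra z0.
have {}Rge (i : 'I_D) : ord_ge R 0 (a i * y ^+ i).
  by apply: ord_ge_le (Rge i); rewrite -Rsum.
have Rpos (i : 'I_D) : i != ord0 -> ord_ge R 1 (a i * y ^+ i).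
  move=> i0; have [ai0|ai0] := eqVneq (a i) 0; first by rewrite ai0 mul0r ord_ge0.
  have := Rge i; rewrite !ord_geE ?mulf_neq0 ?expf_neq0 //.
  have [m Hm] := ratfun_degree trans_u (ra i) ai0.
  rewrite place_ordM ?expf_neq0 // place_ordX (Hm R Ru) RuE RyE => ge0.
  have i1 : (0 < i)%N by rewrite lt0n; apply: contra i0 => /eqP i00; apply/eqP/val_inj.
  have := ltn_ord i; move: (i : nat) ge0 i1 => i' ge0 i1 ltD.
  rewrite -gtz0_ge1 lt_neqAle ge0 andbT eq_sym; apply/eqP => E.
  move: E i1 ltD; clear=> E i1 ltD.
  have E' : D%:Z * (- m) = 2 * i'%:Z by lia.
  have := parity_bound E'; lia.
have := Rge ord0; rewrite expr0 mulr1 => /(ratfun_residue trans_u Ru (ra _))[c Hc].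
exists c; suff : ord_ge R 1 (\sum_(j0 < D) a j0 * y ^+ j0 - iota c).
  by case/orP; [rewrite subr_eq0 => /eqP; left | rewrite -gtz0_ge1; right].
rewrite (bigD1 ord0) //= expr0 mulr1 addrAC; apply: ord_geD => //.
by apply: ord_ge_sum.
Qed.

(** A relation p(u) q(p(u)) = 1 would be an identity of polynomials in u, and
    a nonconstant p is not invertible. *)
Lemma zero_exists_poly (p : {poly F}) : (1 < size p)%N -> exists R, 0 < R (ev p).
Proof.
move=> sp; have p0 : p != 0 by rewrite -size_poly_gt0; apply: ltnW.
have [N fin] := finK (ev p); apply: (zero_exists fin); first exact: trans_u.
move=> q; have evc : eval1 iota (ev p) q = ev (q \Po p).
  elim/poly_ind: q => [|q c IHq]; first by rewrite comp_poly0 !eval1_0.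
  by rewrite comp_polyD comp_polyM comp_polyX comp_polyC !eval1D !eval1M IHq eval1X !eval1C.
rewrite evc -eval1M -subr_eq0 -(eval1_1 iota u) -eval1N -eval1D; apply: trans_u.
rewrite subr_eq0; apply/eqP => pq1.
have q0 : q \Po p != 0 by apply: contra_eq_neq pq1 => ->; rewrite mulr0 eq_sym oner_eq0.
have := size_mul p0 q0; rewrite pq1 size_poly1.
rewrite -size_poly_gt0 in q0; move: sp q0.
by move: (size p) (size (q \Po p)) => a b; lia.
Qed.

Lemma infinity_exists : exists R, R u < 0.
Proof.
have [N fin] := finK u^-1.
have [||R RuV] := zero_exists fin; first by rewrite invr_eq0.
  move=> p; apply/eqP => up1.
  have alg : algebraicOver iota u^-1.
    exists ('X * p - 1).
      apply/eqP => Xp1; have := oner_neq0 F.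
      have := congr1 (fun q : {poly F} => q`_0) Xp1.
      by rewrite coefB coefXM coef1 coef0 sub0r => /eqP; rewrite oppr_eq0 => ->.
    by apply/rootP; rewrite -[LHS]/(eval1 iota u^-1 _) eval1D eval1N eval1M eval1X eval1_1 up1 subrr.
  have [q q0 /rootP qu] := algebraic_inv alg; rewrite invrK in qu.
  by have := trans_u q0; rewrite /eval1 qu eqxx.
by exists R; move: RuV; rewrite place_ordV oppr_gt0.
Qed.

Variable Q : place iota.
Hypothesis Qu : Q u < 0.

Lemma ord_u_off R : ~ R =1 Q -> 0 <= R u.
Proof. by move=> RQ; rewrite leNgt; apply/negP => /infinity_unique/(_ Qu). Qed.

Lemma nongap_D : weierstrass_semigroup Q D.
Proof.
apply: (weierstrassE u0); first by move=> R /ord_u_off.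
by case: (ord_infinity Qu).
Qed.

Hypothesis k0 : (0 < k)%N.

Lemma nongap_D2 : weierstrass_semigroup Q (D + 2).
Proof.
have yu0 : y * u != 0 by rewrite mulf_neq0.
have [QuE QyE] := ord_infinity Qu.
apply: (weierstrassE yu0); last by rewrite place_ordM // QuE QyE; clear; lia.
move=> R /ord_u_off; rewrite le_eqVlt place_ordM // => /orP[/eqP Ru|].
  by rewrite -Ru addr0; apply: ord_y_ge0.
by case/ord_y_zero=> e e0 [-> ->]; move: k0 e0; clear; nia.
Qed.

(** D and D + 2 are coprime: b copies of D + 2 with b = (k+1) m modulo D take
    care of the residue modulo D, since 2 (k+1) = 1 modulo D. *)
Lemma nongap_large m : (D * (D + 2) <= m)%N -> weierstrass_semigroup Q m.
Proof.
move=> mD; pose b := ((m * k.+1) %% D)%N.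
have bD : (b < D)%N by rewrite ltn_mod.
have bm : (b * (D + 2) = m %[mod D])%N.
  rewrite /b modnMml -mulnA.
  have -> : (k.+1 * (D + 2) = k.+2 * D + 1)%N by clear; nia.
  by rewrite mulnDr muln1 mulnA modnMDl.
have lebm : (b * (D + 2) <= m)%N by apply: leq_trans mD; rewrite leq_mul2r ltnW ?orbT.
have := bm => /eqP; rewrite eq_sym eqn_mod_dvd // => /dvdnP[c cE].
have -> : m = (b * (D + 2) + c * D)%N by rewrite -cE subnKC.
by apply: weierstrassD; apply: weierstrassM; [exact: nongap_D2 | exact: nongap_D].
Qed.

(** The Galois group acts on the places. *)
Lemma sigma_place R i : exists R' : place iota, forall z, R' z = R (sigma i z).
Proof.
have period l z : sigma (l * D) z = z.
  elim: l => [|l IHl]; first exact: (sigma0 gen sigma_const sigma_u sigma_y).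
  by rewrite mulSn (sigma_period gen zetaP sigma_const sigma_u sigma_y).
pose o z := R (sigma i z).
have o0 : o 0 = 0 by rewrite /o rmorph0 place_ord0.
have oM z w : z != 0 -> w != 0 ->
    o (z * w) = o z + o w.
  by move=> z0 w0; rewrite /o rmorphM place_ordM ?fmorph_eq0.
have oD z w : z != 0 -> w != 0 -> z + w != 0 ->
    Num.min (o z) (o w) <= o (z + w).
  move=> z0 w0 zw0; rewrite /o rmorphD.
  by apply: place_ordD; rewrite -?rmorphD ?fmorph_eq0.
have oc c : c != 0 -> o (iota c) = 0.
  by move=> c0; rewrite /o sigma_const place_ord_const.
have ot : exists t, o t = 1.
  have [t Rt] := place_uniformizer R; exists (sigma (i * (2 * k)) t).
  rewrite /o -(sigma_add gen sigma_const sigma_u sigma_y).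
  by rewrite -mulnS period.
by exists (Place o0 oM oD oc ot).
Qed.

(** The component is an average of the conjugates of the function, and these
    are regular at R because the function is regular at the conjugates of R;
    none of these conjugates is Q, as u is regular there. *)
Lemma component_regular (a : nat -> K) (j : 'I_D) : (forall j, ratfun iota u (a j)) ->
  (forall R, ~ R =1 Q -> ord_ge R 0 (\sum_(j < D) a j * y ^+ j)) ->
  forall R, 0 <= R u -> ord_ge R 0 (a j * y ^+ j).
Proof.
move=> ra regz R Ru.
rewrite -(component_expansion zetaP D0 sigma_const sigma_u sigma_y ra (ltn_ord j)).
have cM c z : ord_ge R 0 z -> ord_ge R 0 (iota c * z).
  by move=> Rz; rewrite -[0]addr0; apply: ord_geM; rewrite ?ord_ge_const.
apply: (cM); apply: ord_ge_sum => i _; apply: cM.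
have [R' HR'] := sigma_place R i.
rewrite /ord_ge fmorph_eq0 -HR' -/(ord_ge R' 0 _).
suff /regz Hreg : ~ R' =1 Q by exact Hreg.
by move=> R'Q; move: Ru; rewrite -(sigma_u i) -HR' R'Q leNgt Qu.
Qed.

(** Let a = p / q in lowest terms.  If q is not constant, the monomial has a
    pole at some place where q(u) vanishes: this is clear when y is a unit
    there or has a pole.  The other places lie above a root of u^4 - 1, where
    D R(y) = R(u^4 - 1); the roots being simple, this is at most R(q(u)), and
    j < D.  So a is a polynomial, and its order at a place with u = 0 has to
    compensate the pole of y^j. *)
Lemma regular_monomial a j : ratfun iota u a -> a != 0 -> (j < D)%N ->
  (forall R, 0 <= R u -> 0 <= R (a * y ^+ j)) ->
  exists d : nat, Q (a * y ^+ j) = - (2 * j + D * d)%N%:Z /\ (2 * j <= D * d)%N.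
Proof.
move=> /(ratfun_coprime trans_u)[p [q [q0 cpq ->]]] a0 jD reg.
have p0 : p != 0 by apply: contraNneq a0 => ->; rewrite eval1_0 mul0r.
have regE R : 0 <= R u -> 0 <= R (ev p) - R (ev q) + j%:Z * R y.
  by move=> /reg; rewrite place_ordM ?expf_neq0 // place_ordX ord_div ?trans_u.
have sq : (size q <= 1)%N.
  rewrite leqNgt; apply/negP => sq1.
  have pole R : 0 <= R u -> 0 < R (ev q) -> j%:Z * R y < R (ev q) -> False.
    move=> Ru Rq Ry; have := regE R Ru.
    have -> : R (ev p) = 0 by apply: (@ord_eval_coprime _ _ _ _ trans_u R q) => //; rewrite coprimep_sym.
    by rewrite sub0r addrC subr_ge0 leNgt Ry.
  have neg R (r : {poly F}) : (0 < size r)%N -> 0 < R (ev r) -> 0 <= R u.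
    move=> sr Rr; rewrite leNgt; apply/negP => Ru; move: Rr.
    rewrite ord_eval_neg -?size_poly_gt0 // ltNge; case/negP.
    by rewrite mulr_ge0_le0 // ltW.
  have q_ge0 R : 0 <= R u -> forall r : {poly F}, r != 0 -> 0 <= R (ev r).
    by move=> Ru r r0; have := ord_eval_ge0 trans_u r Ru; rewrite ord_geE ?trans_u.
  (* A nonconstant d = gcd (q, X^4 - 1) yields the place above a root of
     X^4 - 1; otherwise any zero of q(u) will do. *)
  pose d := gcdp q ('X^4 - 1).
  have d0 : d != 0 by rewrite gcdp_eq0 negb_and q0.
  have dq := divpK (dvdp_gcdl q ('X^4 - 1)).
  have d4 := divpK (dvdp_gcdr q ('X^4 - 1)).
  have [sd|sd] := leqP (size d) 1.
    have cop : coprimep q ('X^4 - 1) by rewrite /coprimep eqn_leq sd size_poly_gt0.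
    have [R Rq] := zero_exists_poly sq1.
    have Ru : 0 <= R u by apply: neg Rq; rewrite size_poly_gt0.
    apply: (pole R) => //; have := ord_y R.
    rewrite (ord_eval_coprime trans_u cop) // => Dy.
    have Ry : R y <= 0.
      by rewrite -(pmulr_rle0 _ (_ : 0 < D%:Z)) // Dy sub0r oppr_le0 mulr_ge0.
    by apply: le_lt_trans Rq; rewrite mulr_ge0_le0.
  have [R Rd] := zero_exists_poly sd.
  have Ru : 0 <= R u by apply: neg Rd; rewrite size_poly_gt0.
  have c4 : coprimep d (('X^4 - 1) %/ d).
    have : separable_poly (('X^4 - 1) %/ d * d) by rewrite /d d4 separable_Xn_sub_1.
    by rewrite separable_mul coprimep_sym => /and3P[].
  have R4 : R (ev ('X^4 - 1)) = R (ev d).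
    rewrite -{1}d4 eval1M place_ordM ?trans_u ?dvdp_div_eq0 ?dvdp_gcdr //.
    by rewrite (ord_eval_coprime trans_u c4) // add0r.
  have Rq : R (ev d) <= R (ev q).
    rewrite -[in leRHS]dq eval1M place_ordM ?trans_u ?dvdp_div_eq0 ?dvdp_gcdl //.
    by rewrite lerDr q_ge0 // dvdp_div_eq0 ?dvdp_gcdl.
  apply: (pole R) => //; first exact: lt_le_trans Rq.
  apply: lt_le_trans Rq; have := ord_y R; rewrite R4 => Dy.
  have lt : j%:Z < D%:Z by [].
  have {Dy}Dy : D%:Z * R y <= R (ev d) by rewrite Dy lerBlDr lerDl mulr_ge0.
  have [Ry|Ry] := leP (R y) 0; first by apply: le_lt_trans Rd; rewrite mulr_ge0_le0.
  by apply: lt_le_trans Dy; rewrite ltr_pM2r.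
have sq1 : size q = 1%N by apply/eqP; rewrite eqn_leq sq size_poly_gt0.
exists (size p).-1; split.
  have [QuE QyE] := ord_infinity Qu.
  rewrite place_ordM ?expf_neq0 // place_ordX ord_div ?trans_u // !ord_eval_neg //.
  by rewrite sq1 QuE QyE; clear; lia.
have [|R Ru] := @zero_exists_poly 'X; first by rewrite size_polyX.
rewrite eval1X in Ru; have [e e0 [RuE RyE]] := ord_y_zero Ru.
have := regE R (ltW Ru); have := ord_eval_le_size trans_u Ru p0.
have -> : R (ev q) = 0.
  move: sq1 q0 => /eqP/size_poly1P[c c0 ->] _.
  by rewrite eval1C place_ord_const.
rewrite RuE RyE subr0 mulrCA => le1 le2.
move: (le_trans le2 (lerD le1 (lexx _))) e0; clear; nia.
Qed.

Theorem nongap_infinity m : weierstrass_semigroup Q m ->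
  exists j d : nat, m = (2 * j + D * d)%N /\ (2 * j <= D * d)%N.
Proof.
case: m => [|m] Hm; first by exists 0, 0; rewrite !muln0.
have [z [z0 Qz regz]] := weierstrassP (ltn0Sn _) Hm.
have [a ra zE] := expand z; rewrite zE in z0 Qz regz.
have [j [tau [aj0 /(_ Q Qu)[Qsum _ _]]]] := dominant_term ra z0.
have reg := @component_regular a j ra _.
have [|d [Qd jd]] := @regular_monomial (a j) j (ra j) aj0 (ltn_ord j).
  move=> R Ru; have := reg _ R Ru; rewrite ord_geE ?mulf_neq0 ?expf_neq0 //; apply.
  by move=> R' /regz; rewrite ord_geE.
exists j, d; split=> //; by move: Qz; rewrite Qsum Qd; clear; lia.
Qed.

End KummerPlaces.

(** * The function field of the curve as a Kummer extension *)

Section SubstituteY.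
Local Open Scope ring_scope.
Variables (F K : fieldType) (iota : {rmorphism F -> K}).

Lemma eval_at_scale (x y : K) (c : F) (g : {poly {poly F}}) :
  eval_at iota x y (map_poly (comp_poly (c *: 'X)) g) =
  eval_at iota x (iota c * y) g.
Proof.
have E p : eval1 iota y (p \Po (c *: 'X)) = eval1 iota (iota c * y) p.
  elim/poly_ind: p => [|p a IHp]; first by rewrite comp_poly0 !eval1_0.
  rewrite comp_polyD comp_polyM comp_polyX comp_polyC !eval1D !eval1M !eval1C.
  by rewrite IHp -mul_polyC !eval1M !eval1C !eval1X.
elim/poly_ind: g => [|g p IHg]; first by rewrite rmorph0 !eval_at0.
rewrite rmorphD rmorphM /= map_polyX map_polyC /=.
by rewrite !eval_atD !eval_atM !eval_atX !eval_atC IHg E.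
Qed.

Variables (f : {poly {poly F}}) (x y : K).
Hypothesis hK : is_function_field iota f x y.

(** Both substitutions y -> c y and y -> y / c preserve the ideal of the curve,
    so that the first one induces a well defined and injective map on quotients
    of polynomial expressions. *)
Lemma scale_automorphism (c : F) : c != 0 ->
  eval_at iota x (iota c * y) f = 0 -> eval_at iota x (iota c^-1 * y) f = 0 ->
  exists s : {rmorphism K -> K},
    [/\ forall a, s (iota a) = iota a, s x = x & s y = iota c * y].
Proof.
move=> c0 fc fcV.
have sub d g : eval_at iota x (iota d * y) f = 0 ->
    eval_at iota x y g = 0 -> eval_at iota x (iota d * y) g = 0.
  by move=> fd /(eval_at_eq0 hK)[h ->]; rewrite eval_atM fd mulr0.
have nz h : eval_at iota x y h != 0 -> eval_at iota x (iota c * y) h != 0.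
  apply: contra_neq; rewrite -eval_at_scale => /(sub _ _ fcV).
  by rewrite eval_at_scale mulrA -rmorphM divff // rmorph1 mul1r.
have /choice[num Hnum] := eval_at_quotient hK; have /choice[den Hden] := Hnum.
pose s z := eval_at iota x (iota c * y) (num z) / eval_at iota x (iota c * y) (den z).
have sE g h : eval_at iota x y h != 0 -> s (eval_at iota x y g / eval_at iota x y h) =
    eval_at iota x (iota c * y) g / eval_at iota x (iota c * y) h.
  move=> h0; set z := _ / _; have [d0 zE] := Hden z.
  apply/eqP; rewrite /s eqr_div ?nz // -subr_eq0 -!eval_atM -eval_atN -eval_atD.
  apply/eqP/sub => //; apply/eqP; rewrite eval_atD eval_atN !eval_atM subr_eq0.
  by rewrite -eqr_div // -zE.
have s1E g : s (eval_at iota x y g) = eval_at iota x (iota c * y) g.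
  have := sE g 1; rewrite !eval_at1 !divr1; apply; exact: oner_neq0.
have sB : zmod_morphism s.
  move=> z w; have [d0 zE] := Hden z; have [e0 wE] := Hden w.
  rewrite {1}zE {1}wE -mulNr addf_div // -eval_atN -!eval_atM -eval_atD.
  rewrite sE ?eval_atM ?mulf_neq0 // eval_atD !eval_atM eval_atN.
  by rewrite -addf_div ?nz // mulNr.
have sM : monoid_morphism s.
  split; first by have := s1E 1; rewrite !eval_at1.
  move=> z w; have [d0 zE] := Hden z; have [e0 wE] := Hden w.
  rewrite {1}zE {1}wE mulf_div -!eval_atM sE ?eval_atM ?mulf_neq0 //.
  by rewrite -mulf_div.
pose s' : {rmorphism K -> K} := HB.pack s
  (GRing.isZmodMorphism.Build _ _ s sB) (GRing.isMonoidMorphism.Build _ _ s sM).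
exists s'; split.
- by move=> a; have := s1E a%:P%:P; rewrite !eval_atC !eval1C.
- by have := s1E 'X; rewrite !eval_atX.
- by have := s1E ('X%:P); rewrite !eval_atC !eval1X.
Qed.

End SubstituteY.

Section CurveFunctionField.
Local Open Scope ring_scope.
Variables (F K : fieldType) (iota : {rmorphism F -> K}) (q0 k : nat).
Notation D := (2 * k).+1.
Hypothesis hD : (q0 + 1 = 2 * D)%N.
Variables (x y : K).
Notation f := (plane_curve_eqn F q0).
Hypothesis hK : is_function_field iota f x y.
Variable im : F.
Hypothesis im2 : im ^+ 2 = -1.
Hypothesis two0 : 2%:R != 0 :> F.
Hypothesis D0 : D%:R != 0 :> F.
Variable zeta : F.
Hypothesis zetaP : D.-primitive_root zeta.

Lemma curve_size : size f = 5%N.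
Proof.
rewrite /plane_curve_eqn -addrA size_polyDl ?size_polyXn //.
rewrite (leq_ltn_trans (size_polyD _ _)) // size_polyXn -rmorphXn size_polyC.
by case: (_ != 0).
Qed.

Lemma curve_monic : f \is monic.
Proof.
rewrite monicE /plane_curve_eqn -addrA lead_coefDl ?lead_coefXn ?size_polyXn //.
rewrite (leq_ltn_trans (size_polyD _ _)) // size_polyXn -rmorphXn size_polyC.
by case: (_ != 0).
Qed.

Lemma eval_curve a b :
  eval_at iota a b f = a ^+ 4 + a ^+ 2 + b ^+ (2 * D).
Proof.
by rewrite /plane_curve_eqn hD !eval_atD !eval_at_exp eval_atX eval_atC eval1X.
Qed.

Lemma curve_eq : x ^+ 4 + x ^+ 2 + y ^+ (2 * D) = 0.
Proof. by rewrite -eval_curve; apply/(eval_at_eq0 hK); exists 1; rewrite mul1r. Qed.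

(** The equation is monic of degree 4 in X, so that its nonzero multiples have
    degree at least 4 in X. *)
Lemma eval_small_neq0 (g : {poly {poly F}}) :
  (size g <= 4)%N -> g != 0 -> eval_at iota x y g != 0.
Proof.
move=> sg; apply: contra_neq => /(eval_at_eq0 hK)[h gE].
apply/eqP; apply: contraTT sg => g0; rewrite -ltnNge.
have h0 : h != 0 by apply: contraNneq g0 => h0; rewrite gE h0 mul0r.
rewrite gE size_Mmonic ?curve_monic // curve_size addnS /=.
by rewrite -[4%N]add0n ltn_add2r size_poly_gt0.
Qed.

Lemma x_neq0 : x != 0.
Proof.
by rewrite -(eval_atX iota x y); apply: eval_small_neq0; rewrite ?size_polyX ?polyX_eq0.
Qed.

Lemma y_transcendental (p : {poly F}) : p != 0 -> eval1 iota y p != 0.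
Proof.
move=> p0; rewrite -(eval_atC iota x y); apply: eval_small_neq0; last by rewrite polyC_eq0.
by rewrite size_polyC p0.
Qed.

(** With w = y^D / x the equation of the curve reads w^2 + x^2 = -1, a conic,
    which is parametrized by u = w + i x, with inverse i x - w. *)
Definition kummer_u := y ^+ D / x + iota im * x.
Notation u := kummer_u.

Let iota_im2 : iota im ^+ 2 = -1.
Proof. by rewrite -rmorphXn im2 rmorphN1. Qed.

Let im0 : iota im != 0.
Proof.
apply/eqP => i0; have := iota_im2; rewrite i0 expr0n /= => /esym/eqP.
by rewrite oppr_eq0 oner_eq0.
Qed.

Let iota2 : 2%:R != 0 :> K.
Proof. by rewrite -(rmorph_nat iota) fmorph_eq0. Qed.

Lemma kummer_u_inv : u * (iota im * x - y ^+ D / x) = 1.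
Proof.
have x0 := x_neq0.
have yE : y ^+ D * y ^+ D = - (x ^+ 4 + x ^+ 2).
  apply/eqP; rewrite -exprD addnn -mul2n -addr_eq0 addrC; apply/eqP; exact: curve_eq.
rewrite /kummer_u; have -> : (y ^+ D / x + iota im * x) * (iota im * x - y ^+ D / x)
  = (iota im ^+ 2) * x ^+ 2 - (y ^+ D * y ^+ D) / x ^+ 2 by field.
by rewrite iota_im2 yE; field.
Qed.

Lemma kummer_u_neq0 : u != 0.
Proof.
apply/eqP => u0; have := kummer_u_inv; rewrite u0 mul0r => /esym/eqP.
by rewrite oner_eq0.
Qed.

Lemma kummer_uV : u^-1 = iota im * x - y ^+ D / x.
Proof. by apply: (mulfI kummer_u_neq0); rewrite kummer_u_inv divff ?kummer_u_neq0. Qed.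

Lemma x_from_u : x = (u + u^-1) / iota (2%:R * im).
Proof.
rewrite kummer_uV /kummer_u rmorphM rmorph_nat; have x0 := x_neq0.
by field; rewrite im0 iota2 x0.
Qed.

Lemma yD_from_u : y ^+ D = x * ((u - u^-1) / 2%:R).
Proof.
rewrite kummer_uV /kummer_u; have x0 := x_neq0.
by field; rewrite iota2 x0.
Qed.

Lemma kummer_relation : iota (4%:R * im) * u ^+ 2 * y ^+ D = u ^+ 4 - 1.
Proof.
rewrite yD_from_u x_from_u !rmorphM !rmorph_nat; have u0 := kummer_u_neq0.
by field; rewrite im0 iota2 u0.
Qed.

(** If u were algebraic over F, so would be x and y^D, which are rational
    functions of u, and finally y. *)
Lemma kummer_u_transcendental (p : {poly F}) : p != 0 -> eval1 iota u p != 0.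
Proof.
move=> p0; apply/eqP => pu.
have alg_u : algebraicOver iota u by exists p => //; apply/rootP.
have alg_c c : algebraicOver iota (iota c) by apply: algebraic_id.
have alg_x : algebraicOver iota x.
  rewrite x_from_u; apply: algebraic_mul; last by rewrite -fmorphV.
  by apply: algebraic_add => //; apply: algebraic_inv.
have alg_yD : algebraicOver iota (y ^+ D).
  rewrite yD_from_u; apply: algebraic_mul => //; apply: algebraic_mul.
    by apply: algebraic_sub => //; apply: algebraic_inv.
  by rewrite -(rmorph_nat iota) -fmorphV.
have /integral_algebraic[r r0 /rootP ry] : integralOver iota y.
  apply: (@integral_root_monic _ _ _ _ ('X^D - (y ^+ D)%:P)).
  - exact: monicXnsubC.
  - by apply/rootP; rewrite !hornerE ?hornerXn subrr.
  apply/integral_poly => i; rewrite coefB coefXn coefC.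
  apply: integral_sub; first by case: (i == D); [apply: integral1 | apply: integral0].
  by case: (i == 0%N); [apply/integral_algebraic | apply: integral0].
by have := y_transcendental r0; rewrite /eval1 ry eqxx.
Qed.

(** The elements of the field generated by u and y. *)
Definition uy_quotient z := exists g h : {poly {poly F}},
  eval_at iota y u h != 0 /\ z = eval_at iota y u g / eval_at iota y u h.

Lemma uy_eval g : uy_quotient (eval_at iota y u g).
Proof. by exists g, 1; rewrite eval_at1 oner_neq0 divr1. Qed.

Lemma uy_quotientD z w : uy_quotient z -> uy_quotient w -> uy_quotient (z + w).
Proof.
move=> [g [h [h0 ->]]] [g' [h' [h'0 ->]]]; exists (g * h' + g' * h), (h * h').
by rewrite eval_atD !eval_atM mulf_neq0 // addf_div.
Qed.

Lemma uy_quotientM z w : uy_quotient z -> uy_quotient w -> uy_quotient (z * w).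
Proof.
move=> [g [h [h0 ->]]] [g' [h' [h'0 ->]]]; exists (g * g'), (h * h').
by rewrite !eval_atM mulf_neq0 // mulf_div.
Qed.

Lemma uy_quotientV z : uy_quotient z -> uy_quotient z^-1.
Proof.
move=> [g [h [h0 ->]]]; rewrite invf_div.
have [->|g0] := eqVneq (eval_at iota y u g) 0; last by exists h, g.
by rewrite invr0 mulr0 -(eval_at0 iota y u); apply: uy_eval.
Qed.

Lemma uy_const c : uy_quotient (iota c).
Proof. by have := uy_eval c%:P%:P; rewrite eval_atC eval1C. Qed.

Lemma uy_quotient_all z : uy_quotient z.
Proof.
have uy_u : uy_quotient u by have := uy_eval 'X%:P; rewrite eval_atC eval1X.
have uy_y : uy_quotient y by have := uy_eval 'X; rewrite eval_atX.
have uy_x : uy_quotient x.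
  rewrite x_from_u; apply: uy_quotientM; last exact/uy_quotientV/uy_const.
  by apply: uy_quotientD => //; apply: uy_quotientV.
have uy_p p : uy_quotient (eval1 iota y p).
  elim/poly_ind: p => [|p c IHp].
    by rewrite eval1_0 -(rmorph0 iota); apply: uy_const.
  rewrite eval1D eval1M eval1X eval1C; apply: uy_quotientD; last exact: uy_const.
  exact: uy_quotientM.
have uy_g g : uy_quotient (eval_at iota x y g).
  elim/poly_ind: g => [|g p IHg].
    by rewrite eval_at0 -(rmorph0 iota); apply: uy_const.
  rewrite eval_atD eval_atM eval_atX eval_atC; apply: uy_quotientD => //.
  exact: uy_quotientM.
have [g [h [_ ->]]] := eval_at_quotient hK z.
by apply: uy_quotientM => //; apply: uy_quotientV.
Qed.

Lemma curve_automorphism i : exists s : {rmorphism K -> K},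
  [/\ forall c, s (iota c) = iota c, s u = u & s y = iota (zeta ^+ i) * y].
Proof.
have z0 : zeta ^+ i != 0.
  apply/expf_neq0/eqP => z0; have := prim_expr_order zetaP.
  by rewrite z0 expr0n => /esym/eqP; rewrite oner_eq0.
have zD c : c ^+ D = 1 -> (iota c * y) ^+ D = y ^+ D.
  by move=> cD; rewrite exprMn -rmorphXn cD rmorph1 mul1r.
have ziD : (zeta ^+ i) ^+ D = 1.
  by rewrite -exprM mulnC exprM (prim_expr_order zetaP) expr1n.
have fc c : c ^+ D = 1 -> eval_at iota x (iota c * y) f = 0.
  move=> cD; rewrite eval_curve mulnC exprM zD // -exprM mulnC; exact: curve_eq.
have [||s [sc sx sy]] := scale_automorphism hK z0.
- exact: fc.
- by apply: fc; rewrite exprVn ziD invr1.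
exists s; split=> //.
by rewrite /kummer_u rmorphD fmorph_div rmorphXn rmorphM sc sx sy zD.
Qed.

Hypothesis k0 : (0 < k)%N.

Theorem reference_place : exists Q : place iota,
  [/\ rational_place Q,
      forall n, (D * (D + 2) <= n)%N -> weierstrass_semigroup Q n &
      forall n, weierstrass_semigroup Q n ->
        exists j d : nat, n = (2 * j + D * d)%N /\ (2 * j <= D * d)%N].
Proof.
have /choice[sigma Hsigma] := curve_automorphism.
have sc i c : sigma i (iota c) = iota c by case: (Hsigma i).
have su i : sigma i u = u by case: (Hsigma i).
have sy i : sigma i y = iota (zeta ^+ i) * y by case: (Hsigma i).
have fin t : exists N, finite_over iota t N.
  exact: (function_field_finite (n := 3) hK curve_monic curve_size).
have four0 : 4%:R != 0 :> F by rewrite (natrM _ 2 2) mulf_neq0.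
have kappa0 : 4%:R * im != 0.
  by rewrite mulf_neq0 //; move: im0; rewrite fmorph_eq0.
have trans := kummer_u_transcendental.
have [Q Qu] := infinity_exists trans fin.
exists Q; split.
- exact: (infinity_rational trans kappa0 kummer_relation uy_quotient_all zetaP D0 sc su sy).
- by move=> n; apply: (nongap_large trans kappa0 kummer_relation uy_quotient_all zetaP D0 sc su sy).
- by move=> n; apply: (nongap_infinity trans kappa0 kummer_relation uy_quotient_all zetaP D0 four0 sc su sy fin).
Qed.

End CurveFunctionField.

(** * Constants in the finite field *)

(** The multiplicative group is cyclic of order |F| - 1. *)
Lemma finField_primitive_root (F : finFieldType) n :
  (0 < n)%N -> (n %| #|F|.-1)%N -> exists z : F, (n.-primitive_root z)%R.
Proof.
move=> n0 nF; have F1 : (0 < #|F|.-1)%N by rewrite -subn1 subn_gt0 finNzRing_gt1.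
have : has #|F|.-1.-primitive_root%R (enum (predC1 (0%R : F))).
  apply: has_prim_root => //.
  - apply/allP => z; rewrite mem_enum => /= z0; apply/unity_rootP/(mulfI z0).
    by rewrite -exprS prednK ?(ltnW (finNzRing_gt1 F)) // expf_card mulr1.
  - exact: enum_uniq.
  - by rewrite -cardE cardC1.
case/hasP=> z _ zP; exists (z ^+ (#|F|.-1 %/ n))%R.
exact: (dvdn_prim_root zP nF).
Qed.

Lemma primitive4_square (F : fieldType) (z : F) :
  (4.-primitive_root z -> z ^+ 2 = -1)%R.
Proof.
move=> zP; have := prim_expr_order zP; rewrite (exprM z 2 2) => /eqP.
rewrite -subr_eq0 subr_sqr_1 mulf_eq0 subr_eq0 addr_eq0 => /orP[|/eqP//].
by rewrite -(prim_order_dvd zP).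
Qed.

Lemma finField_card_natr_eq0 (F : finFieldType) q0 : prime_power q0 ->
  #|F| = (q0 ^ 2)%N -> (q0%:R = 0 :> F)%R.
Proof.
move=> [p [k [pp k0 ->]]]; rewrite -expnM => cF.
have pF := card_finPcharP cF pp.
by apply/eqP; rewrite -(dvdn_pcharf pF) -{1}[p]expn1 dvdn_exp2l.
Qed.

(** * Counting gaps *)

Section GeneratedSemigroup.
Implicit Type s : seq nat.

Lemma generated_mem s m : m \in s -> generated_semigroup s m.
Proof.
move=> ms; have lt : (index m s < size s)%N by rewrite index_mem.
exists (fun i => i == index m s : nat).
rewrite (bigD1 (Ordinal lt)) //= eqxx mul1n nth_index // big1 ?addn0 // => i ij.
by case: eqP => // iE; case/eqP: ij; apply/val_inj.
Qed.

Lemma generatedD s m n : generated_semigroup s m -> generated_semigroup s n ->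
  generated_semigroup s (m + n).
Proof.
move=> [c ->] [d ->]; exists (fun i => c i + d i).
by rewrite -big_split; apply: eq_bigr => i _; rewrite mulnDl.
Qed.

Lemma generated0 s : generated_semigroup s 0.
Proof. by exists (fun=> 0); rewrite big1. Qed.

Lemma generated_weierstrass (F K : fieldType) (iota : {rmorphism F -> K})
    (P : place iota) s n :
  (forall m, m \in s -> weierstrass_semigroup P m) ->
  generated_semigroup s n -> weierstrass_semigroup P n.
Proof.
move=> Hs [c ->]; elim/big_ind: _ => [||i _]; first exact: weierstrass0.
  exact: weierstrassD.
exact/weierstrassM/Hs/mem_nth.
Qed.

End GeneratedSemigroup.

Section Counting.
Variable k : nat.
Hypothesis k0 : 0 < k.

(** The gaps of the semigroup generated by [generators]; with D = 2k + 1 the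
    generators are D and the interval from 3k + 2 to 2D. *)
Definition generator_gaps := iota 1 (2 * k) ++ iota (2 * k + 2) k ++ iota (4 * k + 3) k.

Lemma mem_generators q0 m : q0 + 1 = 2 * (2 * k).+1 ->
  (m \in generators q0 (2 * k).+1) =
  (3 * k + 2 <= m <= 4 * k + 2) || (m == (2 * k).+1).
Proof.
move=> hq; rewrite /generators mem_rcons inE hq orbC.
have -> : ((2 * k).+1 - 1) %/ 2 = k by rewrite subn1 /= mulKn.
have -> : 2 * (2 * k).+1 - (2 * k).+1 = (2 * k).+1 by lia.
congr (_ || _); apply/mapP/idP => [[j]|mk].
  by rewrite mem_iota => jk ->; lia.
by exists (4 * k + 2 - m); rewrite ?mem_iota; lia.
Qed.

(** Starting from the interval of generators, adding D, the least and the
    greatest element of the interval reaches every number from 5k + 3 to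
    8k + 4; the following ones are reached by repeatedly adding D. *)
Lemma generated_or_gap q0 n : q0 + 1 = 2 * (2 * k).+1 ->
  generated_semigroup (generators q0 (2 * k).+1) n \/ n \in generator_gaps.
Proof.
move=> hq; pose S := generated_semigroup (generators q0 (2 * k).+1).
have gen m : (3 * k + 2 <= m <= 4 * k + 2) || (m == (2 * k).+1) -> S m.
  by rewrite -(mem_generators _ hq) => /generated_mem.
have add m l : m <= l -> S m -> S (l - m) -> S l.
  by move=> ml Sm Sl; rewrite -(subnKC ml); apply: generatedD.
have large m : 5 * k + 3 <= m -> S m.
  elim/ltn_ind: m => m IHm mk.
  have [m1|m1] := leqP m (6 * k + 3).
    by apply: (add (2 * k).+1); [lia | apply: gen; lia | apply: gen; lia].
  have [m2|m2] := leqP m (7 * k + 4).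
    by apply: (add (3 * k + 2)); [lia | apply: gen; lia | apply: gen; lia].
  have [m3|m3] := leqP m (8 * k + 4).
    by apply: (add (4 * k + 2)); [lia | apply: gen; lia | apply: gen; lia].
  by apply: (add (2 * k).+1); [lia | apply: gen; lia | apply: IHm; lia].
rewrite /generator_gaps !mem_cat !mem_iota.
have [nk|nk] := leqP (5 * k + 3) n; first by left; apply: large.
have [->|n0] := posnP n; first by left; apply: generated0.
have [n1|n1] := boolP ((3 * k + 2 <= n <= 4 * k + 2) || (n == (2 * k).+1)).
  by left; apply: gen.
by right; lia.
Qed.

(** Positive integers that are not of the form 2j + D d with 2j <= D d: all
    those less than D, the even ones between D and 2D, and the odd ones between
    2D and 3D. *)
Definition reference_gaps := iota 1 (2 * k) ++
  [seq 2 * k + 2 + 2 * i | i <- iota 0 k] ++ [seq 4 * k + 3 + 2 * i | i <- iota 0 k].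

Lemma reference_gaps_uniq : uniq reference_gaps.
Proof.
rewrite /reference_gaps !cat_uniq iota_uniq !map_inj_uniq ?iota_uniq; try by move=> i j; lia.
rewrite andbT /=; apply/andP; split.
  apply/hasPn => m; rewrite mem_cat !mem_iota => /orP[]/mapP[i]; rewrite mem_iota; lia.
apply/hasPn => m /mapP[i]; rewrite mem_iota => ik ->.
by apply/mapP => -[j]; rewrite mem_iota; lia.
Qed.

Lemma reference_gapsP b : b \in reference_gaps ->
  ~ exists j d : nat, b = 2 * j + (2 * k).+1 * d /\ 2 * j <= (2 * k).+1 * d.
Proof.
rewrite /reference_gaps !mem_cat mem_iota => bL [j [d [bE jd]]].
have : d = 0 \/ d = 1 \/ 2 <= d by lia.
case/orP: bL => [b1|/orP[]/mapP[i]]; rewrite ?mem_iota.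
- by move=> [?|[?|?]]; subst; nia.
- by move=> ik bE' [?|[?|?]]; subst; nia.
- move=> ik bE' [?|[?|?]]; [subst; nia | subst; nia |].
  have : d = 2 \/ 3 <= d by lia.
  by move=> [?|?]; [subst; lia | nia].
Qed.

Lemma size_gaps : size generator_gaps = size reference_gaps.
Proof. by rewrite /generator_gaps /reference_gaps !size_cat !size_map !size_iota. Qed.

End Counting.

Theorem theorem4p2 (q0 Delta : nat) (hq0 : prime_power q0)
    (hDelta : (q0 + 1 = 2 * Delta)%N) (hprime : prime Delta)
    (hgt3 : (3 < Delta)%N)
    (F : finFieldType) (hF : #|F| = (q0 ^ 2)%N)
    (K : fieldType) (iota : {rmorphism F -> K}) (x y : K)
    (hK : is_function_field iota (plane_curve_eqn F q0) x y)
    (P1 : place iota) (hP1 : rational_place P1)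
    (hgens : forall m : nat, m \in generators q0 Delta ->
       weierstrass_semigroup P1 m) :
  forall n : nat, weierstrass_semigroup P1 n <->
    generated_semigroup (generators q0 Delta) n.
Proof.
have [k DE] : exists k, Delta = (2 * k).+1.
  exists Delta./2; case: (even_prime hprime) => [D2|oD]; first by rewrite D2 in hgt3.
  by rewrite -[LHS]odd_double_half oD mul2n.
rewrite DE in hDelta hprime hgt3 hgens *; clear Delta DE.
have k0 : 0 < k by lia.
(* The characteristic divides q0, so that 2 D = q0 + 1 is 1 in F: both 2 and D
   are invertible.  Moreover 4 and D divide q0^2 - 1, the order of the
   multiplicative group. *)
have q0F := finField_card_natr_eq0 hq0 hF.
have D2 : (2%:R * (2 * k).+1%:R = 1 :> F)%R.
  by rewrite -natrM -hDelta natrD q0F add0r.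
have two0 : (2%:R != 0 :> F)%R.
  by apply: contra_eq_neq D2 => ->; rewrite mul0r eq_sym oner_neq0.
have D0 : ((2 * k).+1%:R != 0 :> F)%R.
  by apply: contra_eq_neq D2 => ->; rewrite mulr0 eq_sym oner_neq0.
have cF : #|F|.-1 = 4 * (2 * k).+1 * (2 * k) by rewrite hF; nia.
have [zeta zetaP] : exists z : F, ((2 * k).+1.-primitive_root z)%R.
  by apply: finField_primitive_root => //; rewrite cF dvdn_mulr // dvdn_mull.
have [im imP] : exists z : F, (4.-primitive_root z)%R.
  by apply: finField_primitive_root => //; rewrite cF -mulnA dvdn_mulr.
have im2 := primitive4_square imP.
have [Q [ratQ largeQ gapsQ]] := reference_place hDelta hK im2 two0 D0 zetaP k0.
have HD : weierstrass_semigroup P1 (2 * k).+1.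
  by apply: hgens; rewrite (mem_generators k0 _ hDelta) eqxx orbT.
have [g [gapg injg]] := gap_injection hP1 ratQ (ltn0Sn _) HD largeQ.
have refgap b : b \in reference_gaps k -> ~ weierstrass_semigroup Q b.
  by move=> /reference_gapsP bgap /gapsQ; apply: bgap.
have sub : {subset map g (reference_gaps k) <= generator_gaps k}.
  move=> _ /mapP[b /refgap/gapg gapb ->].
  have [Sg|//] := generated_or_gap k0 (g b) hDelta.
  by case: gapb; apply: generated_weierstrass Sg.
have uniqg : uniq (map g (reference_gaps k)).
  rewrite map_inj_in_uniq ?reference_gaps_uniq // => b b' /refgap gapb /refgap gapb'.
  exact: injg.
(* The images of the 4 k reference gaps fill the 4 k possible gaps. *)
have [|_ eqgaps] := uniq_min_size uniqg sub; first by rewrite size_map size_gaps.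
move=> n; split=> [Hn|]; last exact: generated_weierstrass.
have [//|] := generated_or_gap k0 n hDelta.
by rewrite -eqgaps => /mapP[b /refgap/gapg gapb nE]; case: gapb; rewrite -nE.
Qed.
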